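(* Let $V, W$ be real Banach spaces, let $f \in C^1([0,\infty) \times V, V)$, and let $\Theta \in C^1([0,\infty) \times V, GL(V,W))$ satisfy $$\sup_{t \ge 0,\, u \in V} \max\big(\|\Theta(t,u)\|, \|\Theta(t,u)^{-1}\|\big) = C < \infty.$$ For $t \ge 0$ and $u \in V$, let $$G(t,u) := \partial_t \Theta(t,u) + D_u\Theta(t,u)[f(t,u)] + \Theta(t,u)\, D_u f(t,u) \in \mathcal{B}(V,W),$$ and suppose that for some $\lambda \in \mathbb{R}$, $$\sup_{t \ge 0,\, u \in V}\; M\big(G(t,u)\, \Theta(t,u)^{-1}\big) \le \lambda,$$ where $M$ is computed in $W$. Then any two solutions $u_1, u_2$ of $\dot u = f(t,u)$ satisfy $$\|u_1(t) - u_2(t)\| \le C^2 e^{\lambda t} \|u_1(0) - u_2(0)\| \quad \text{for all } t \ge 0.$$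
   Context: For a real Banach space $X$, the right semi-inner product is $(u,v)_+ := \|u\| \lim_{h \to 0^+} \frac{\|u + hv\| - \|u\|}{h}$. For a bounded linear operator $A: X \to X$, $M(A) := \sup_{v \ne 0} \frac{(v, Av)_+}{\|v\|^2}$. $GL(V,W)$ is the set of bijective bounded linear operators $V \to W$. $D$ denotes the Fréchet derivative, and $D_u\Theta(t,u)[h]$ is the derivative of $\Theta$ in $u$ applied to $h$. The operator $G(t,u)$ is the derivative along solutions: $\frac{d}{dt}[\Theta(t,u(t))\,\delta u(t)] = G(t,u(t))\,\delta u(t)$ whenever $\dot{\delta u} = D_u f(t,u(t))\,\delta u$. Solutions are continuously differentiable curves $[0,\infty) \to V$ satisfying the equation. *)

(* Defs.v *)
From HB Require Import structures.
From mathcomp Require Import all_boot all_order all_algebra.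
From mathcomp Require Import all_classical all_reals all_analysis.
Set Implicit Arguments.
Unset Strict Implicit.
Unset Printing Implicit Defensive.
Import Order.TTheory GRing.Theory Num.Theory.
Import numFieldNormedType.Exports.
Local Open Scope classical_set_scope.
Local Open Scope ring_scope.

Section Defs.
Variable R : realType.

Definition islinear (V W : normedModType R) (L : V -> W) : Prop :=
  forall (a : R) (u v : V), L (a *: u + v) = a *: L u + L v.

Definition bounded_lin (V W : normedModType R) (L : V -> W) : Prop :=
  islinear L /\ continuous L.

Definition opnorm (V W : normedModType R) (L : V -> W) : \bar R :=
  ereal_sup [set (`|L v|)%:E | v in [set v : V | `|v| <= 1]].

Definition opnorm2 (V W : normedModType R) (K : V -> V -> W) : \bar R :=
  ereal_sup [set opnorm (K h) | h in [set h : V | `|h| <= 1]].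

Definition semi_ip (W : normedModType R) (u v : W) : R :=
  `|u| * lim ((fun h : R => (`|u + h *: v| - `|u|) / h) @ at_right 0).

Definition logM (W : normedModType R) (A : W -> W) : \bar R :=
  ereal_sup [set (semi_ip v (A v) / `|v| ^+ 2)%:E | v in [set v : W | v != 0]].

Definition hs_diff (V X : normedModType R) (F : R -> V -> X)
    (Ft : R -> V -> X) (Fu : R -> V -> V -> X) : Prop :=
  forall t u, 0 <= t ->
    bounded_lin (Fu t u) /\
    forall e : R, 0 < e -> exists2 d : R, 0 < d &
      forall (s : R) (h : V), 0 <= t + s -> `|s| < d -> `|h| < d ->
        `|F (t + s) (u + h) - F t u - (s *: Ft t u + Fu t u h)|
          <= e * (`|s| + `|h|).

Definition hs_diff_op (V W : normedModType R) (Th : R -> V -> V -> W)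
    (Tht : R -> V -> V -> W) (Thu : R -> V -> V -> V -> W) : Prop :=
  forall t u, 0 <= t ->
    bounded_lin (Tht t u) /\
    (forall (a : R) (h1 h2 v : V),
       Thu t u (a *: h1 + h2) v = a *: Thu t u h1 v + Thu t u h2 v) /\
    (forall h, bounded_lin (Thu t u h)) /\ (opnorm2 (Thu t u) < +oo)%E /\
    forall e : R, 0 < e -> exists2 d : R, 0 < d &
      forall (s : R) (h : V), 0 <= t + s -> `|s| < d -> `|h| < d ->
        (opnorm (fun v => (Th (t + s) (u + h) v - Th t u v
                         - (s *: Tht t u v + Thu t u h v))%R)
          <= (e * (`|s| + `|h|))%:E)%E.

Definition hs_continuous (V : normedModType R) (X : Type) (g : R -> V -> X)
    (dist : X -> X -> \bar R) : Prop :=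
  forall t u, 0 <= t -> forall e : R, 0 < e -> exists2 d : R, 0 < d &
    forall (s : R) (h : V), 0 <= t + s -> `|s| < d -> `|h| < d ->
      (dist (g (t + s)%R (u + h)%R) (g t u) <= e%:E)%E.

Definition dist_vec (X : normedModType R) (x y : X) : \bar R := (`|x - y|)%:E.
Definition dist_op (V W : normedModType R) (A B : V -> W) : \bar R :=
  opnorm (fun v => A v - B v).
Definition dist_op2 (V W : normedModType R) (A B : V -> V -> W) : \bar R :=
  opnorm2 (fun h v => A h v - B h v).

Definition C1_hs_vec (V : normedModType R) (f : R -> V -> V)
    (fu : R -> V -> V -> V) : Prop :=
  exists ft : R -> V -> V,
    hs_diff f ft fu /\ hs_continuous ft (@dist_vec V) /\
    hs_continuous fu (@dist_op V V).

Definition C1_hs_op (V W : normedModType R) (Th : R -> V -> V -> W)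
    (Tht : R -> V -> V -> W) (Thu : R -> V -> V -> V -> W) : Prop :=
  hs_diff_op Th Tht Thu /\ hs_continuous Tht (@dist_op V W) /\
  hs_continuous Thu (@dist_op2 V W).

Definition C1_curve (V : normedModType R) (u u' : R -> V) : Prop :=
  (forall t, 0 <= t -> forall e : R, 0 < e -> exists2 d : R, 0 < d &
     forall s : R, 0 <= t + s -> `|s| < d ->
       `|u (t + s) - u t - s *: u' t| <= e * `|s|) /\
  (forall t, 0 <= t -> forall e : R, 0 < e -> exists2 d : R, 0 < d &
     forall s : R, 0 <= t + s -> `|s| < d -> `|u' (t + s) - u' t| <= e).

Definition is_solution (V : normedModType R) (f : R -> V -> V) (u : R -> V) : Prop :=
  exists u' : R -> V, C1_curve u u' /\ forall t, 0 <= t -> u' t = f t (u t).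

Definition Gop (V W : normedModType R) (f : R -> V -> V) (fu : R -> V -> V -> V)
    (Th : R -> V -> V -> W) (Tht : R -> V -> V -> W)
    (Thu : R -> V -> V -> V -> W) (t : R) (u : V) : V -> W :=
  fun v => Tht t u v + Thu t u (f t u) v + Th t u (fu t u v).

End Defs.

(* Main.v *)
(** Along a solution x, the transported difference Theta(t, x(t)) (y(t) - x(t)) to a
    nearby solution y has a norm whose right Dini derivative is at most lambda + eps times
    itself, as long as y stays in a tube around x where f is uniformly close to its
    linearization. Hence solutions starting near x(0) stay within the factor
    C^2 exp((lambda + eps) t) of x, and they exist on the whole interval [0, T].

    For two arbitrary solutions, move the initial value along the segment from u1(0) to
    u2(0). Intermediate solutions might a priori blow up, but the local estimate makes
    s |-> (solution starting at the point s of the segment) Lipschitz for the sup norm on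
    [0, T], so by completeness the set of admissible s is closed as well as open. The
    local Lipschitz bounds then add up along the segment, and eps tends to 0. *)

Require Import Defs.
From HB Require Import structures.
From mathcomp Require Import all_boot all_order all_algebra.
From mathcomp Require Import all_classical all_reals all_analysis.
From mathcomp Require Import ring lra.
Set Implicit Arguments.
Unset Strict Implicit.
Unset Printing Implicit Defensive.
Import Order.TTheory GRing.Theory Num.Theory.
Import numFieldNormedType.Exports.
Local Open Scope classical_set_scope.
Local Open Scope ring_scope.

(** Bounded sets of an infinite-dimensional [V] are not relatively compact, so [f] need not have a
    uniform modulus of differentiability near the segment of initial values. Compactness is
    available only for time intervals: every radius is uniform in time along one solution, but may
    shrink arbitrarily from one solution to the next. This is why the segment is handled by real
    induction and by a mean value inequality with pointwise radii, not by a subdivision into equal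
    pieces. Chaining loses nothing, because the local estimates share one constant and are added
    over the parameter of the segment, not multiplied over time. Finite differences of solutions
    replace the derivative of the flow in the initial value: the nonlinear remainder is small
    relative to the difference and is absorbed by eps, so that neither the variational equation nor
    differentiable dependence on initial data has to be established. *)

(** * Real induction and growth inequalities on an interval *)

(** The supremum of the times up to which [Q] holds throughout belongs to that set by the left-limit
    step, and the step to the right prevents it from lying below [b]. All compactness and
    open-closed arguments below reduce to this. *)
Lemma real_induction (R : realType) (a b : R) (Q : R -> Prop) :
  Q a ->
  (forall t : R, a <= t < b -> Q t -> exists2 d : R, 0 < d &
     forall s : R, t < s < t + d -> s <= b -> Q s) ->
  (forall t : R, a < t <= b -> (forall s : R, a <= s < t -> Q s) -> Q t) ->
  forall t : R, a <= t <= b -> Q t.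
Proof.
move=> Qa Qr Ql t0 /andP[at0 t0b].
have ab : a <= b := le_trans at0 t0b.
pose S := [set t : R | a <= t <= b /\ forall s : R, a <= s <= t -> Q s].
have Sa : S a.
  by split; [rewrite lexx ab|move=> s; rewrite -eq_le => /eqP <-].
have supS : has_sup S.
  by split; [exists a|exists b => t [/andP[]]].
set m := sup S.
have am : a <= m by apply: ub_le_sup => //; case: supS.
have mb : m <= b by apply: ge_sup; [exists a|move=> t [/andP[]]].
have below s : a <= s < m -> Q s.
  move=> /andP[as_ sm].
  have ms0 : 0 < m - s by rewrite subr_gt0.
  have [e [_ He] se] := sup_adherent ms0 supS.
  by apply: He; rewrite as_ /=; move: se; rewrite -/m => se; lra.
have Qm : Q m.
  have [ma|ma] := leP m a; first by rewrite (_ : m = a) //; apply/eqP; rewrite eq_le ma am.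
  by apply: Ql => //; rewrite ma mb.
have below' s : a <= s <= m -> Q s.
  move=> /andP[as_]; rewrite le_eqVlt => /orP[/eqP -> //|sm].
  by apply: below; rewrite as_.
have [mltb|bm] := ltP m b; last by apply: below'; rewrite at0 (le_trans t0b).
have [d d0 Hd] := Qr m (introT andP (conj am mltb)) Qm.
pose s := Num.min (m + d / 2) b.
have ms : m < s by rewrite lt_min mltb andbT ltrDl divr_gt0.
suff : S s by move=> /ub_le_sup -/(_ (proj2 supS)); rewrite leNgt ms.
split; first by rewrite ge_min lexx orbT andbT (le_trans am (ltW ms)).
move=> r /andP[ar rs]; have [rm|mr] := leP r m; first by apply: below'; rewrite ar.
apply: Hd; rewrite ?mr /=; last by apply: le_trans rs _; rewrite ge_min lexx orbT.
by apply: le_lt_trans rs _; rewrite gt_min ltrD2l; apply/orP; left; lra.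
Qed.

(* The growth bound is required only while the conclusion holds, so that it may
   depend on [phi] staying below a threshold. *)
Lemma le_linear_growth (R : realType) (a b M : R) (phi : R -> R) :
  (forall t : R, a < t <= b -> forall e : R, 0 < e -> exists2 d : R, 0 < d &
     forall s : R, a <= s < t -> t - s < d -> phi t <= phi s + e) ->
  (forall t : R, a <= t < b -> phi t <= phi a + M * (t - a) ->
     exists2 d : R, 0 < d &
       forall h : R, 0 < h < d -> t + h <= b -> phi (t + h) <= phi t + M * h) ->
  forall t : R, a <= t <= b -> phi t <= phi a + M * (t - a).
Proof.
move=> lc gr; apply: real_induction.
- by rewrite subrr mulr0 addr0.
- move=> t tab Qt; have [d d0 Hd] := gr t tab Qt; exists d => // s /andP[ts std] sb.
  have := Hd (s - t); rewrite subrKC => /(_ _ sb) H.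
  have {}H : phi s <= phi t + M * (s - t) by apply: H => //; lra.
  by apply: le_trans H _; lra.
- move=> t tab Q; apply/ler_addgt0Pr => e e0.
  have [d d0 Hd] := lc t tab (e / 2) ltac:(lra).
  have [ta tb] := andP tab.
  pose r := Num.min (d / 2) (Num.min (t - a) (e / 2 / (1 + `|M|))).
  have M0 : 0 < 1 + `|M| by rewrite ltr_pwDl.
  have r0 : 0 < r by rewrite !lt_min !divr_gt0 //= ?subr_gt0 ?ta//; lra.
  have rd : r <= d / 2 by rewrite ge_min lexx.
  have ra : r <= t - a by rewrite !ge_min lexx /= orbT.
  have rM : `|M| * r <= e / 2.
    have : r <= e / 2 / (1 + `|M|) by rewrite !ge_min lexx /= !orbT.
    rewrite ler_pdivlMr // => rM.
    by apply: le_trans rM; rewrite mulrC ler_pM2l //; lra.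
  have H1 := Hd (t - r) ltac:(lra) ltac:(lra).
  have H2 := Q (t - r) ltac:(lra).
  have H3 : - (M * r) <= `|M| * r.
    by rewrite -mulNr ler_pM2r // -normrN ler_norm.
  lra.
Qed.

(* Mean value inequality for [fun t => g t - t *: c]. *)
Lemma norm_sub_le_linear (R : realType) (X : normedModType R) (a b M : R)
    (g : R -> X) (c : X) : a <= b ->
  (forall t : R, a <= t <= b -> forall e : R, 0 < e -> exists2 d : R, 0 < d &
     forall s : R, a <= t + s <= b -> `|s| < d ->
       `|g (t + s) - g t - s *: c| <= (M + e) * `|s|) ->
  `|g b - g a - (b - a) *: c| <= M * (b - a).
Proof.
move=> ab Hg; apply/ler_addgt0Pr => e e0.
(* The slack in the slope adds up to at most [e] over the interval. The summand 1, here and in later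
   denominators, keeps the quotient meaningful when the other term vanishes. *)
pose N := M + e / (1 + (b - a)).
have ba1 : 0 < 1 + (b - a) by lra.
have e1 : 0 < e / (1 + (b - a)) by rewrite divr_gt0.
pose phi t := `|g t - g a - (t - a) *: c|.
have stepE t s : g (t + s) - g a - (t + s - a) *: c =
    (g t - g a - (t - a) *: c) + (g (t + s) - g t - s *: c).
  rewrite (_ : t + s - a = (t - a) + s); last by lra.
  rewrite scalerDl opprD [RHS]addrACA; congr (_ + _).
  by rewrite [RHS]addrC [RHS]addrA subrK.
have : forall t : R, a <= t <= b -> phi t <= phi a + N * (t - a).
  apply: le_linear_growth.
  - move=> t /andP[ta tb] e2 e20; have [d d0 Hd] := Hg t ltac:(lra) _ e1.
    exists (Num.min d (e2 / (1 + `|N|))); rewrite ?lt_min ?d0 ?divr_gt0 ?ltr_pwDl //.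
    move=> s /andP[as_ st]; rewrite lt_min => /andP[sd].
    rewrite ltr_pdivlMr ?ltr_pwDl // => se.
    have := Hd (s - t); rewrite subrKC => /(_ ltac:(lra)).
    rewrite ltr0_norm ?subr_lt0 // opprB => /(_ sd) H.
    have NN : N * (t - s) <= `|N| * (t - s) by rewrite ler_wpM2r ?ler_norm //; lra.
    have := stepE t (s - t); rewrite subrKC => E.
    have : phi t <= phi s + `|g s - g t - (s - t) *: c|.
      by rewrite /phi E -{1}(addrK (g s - g t - (s - t) *: c) (g t - g a - (t - a) *: c)) ler_normB.
    rewrite -/N in H; nra.
  - move=> t /andP[ta tb] _; have [d d0 Hd] := Hg t ltac:(lra) _ e1.
    exists d => // h /andP[h0 hd] thb.
    have := Hd h ltac:(lra); rewrite gtr0_norm // => /(_ hd) H.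
    by rewrite /phi stepE; apply: le_trans (ler_normD _ _) _; rewrite lerD2l.
move=> /(_ b); rewrite lexx ab => /(_ isT).
rewrite /phi !subrr scale0r subr0 normr0 add0r => /le_trans; apply.
rewrite /N mulrDl lerD2l mulrAC ler_pdivrMr // ler_pM2l //; lra.
Qed.

(** The radius may depend on the point without control, since only the slope at each point enters
    the mean value inequality, taken here with the zero vector. *)
Lemma lipschitz_of_local (R : realType) (X : normedModType R) (a b M : R)
    (g : R -> X) : a <= b ->
  (forall t : R, a <= t <= b -> exists2 d : R, 0 < d &
     forall s : R, a <= s <= b -> `|s - t| < d -> `|g s - g t| <= M * `|s - t|) ->
  `|g b - g a| <= M * (b - a).
Proof.
move=> ab Hg; have := @norm_sub_le_linear _ X a b M g 0 ab.
rewrite scaler0 subr0; apply => t tab e e0; have [d d0 Hd] := Hg t tab.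
exists d => // s ts sd; rewrite scaler0 subr0.
have := Hd (t + s) ts; rewrite (addrC t) addrK => /(_ sd) /le_trans; apply.
by rewrite ler_wpM2r // lerDl ltW.
Qed.

(** Compactness of the interval for properties that survive shrinking the radius: two radii on
    overlapping pieces are replaced by their minimum. *)
Lemma uniform_radius (R : realType) (a b : R) (P : R -> R -> Prop) :
  a <= b ->
  (forall t r r' : R, 0 < r' <= r -> P t r -> P t r') ->
  (forall t0 : R, a <= t0 <= b -> exists2 r : R, 0 < r &
     forall t : R, a <= t <= b -> `|t - t0| < r -> P t r) ->
  exists2 r : R, 0 < r & forall t : R, a <= t <= b -> P t r.
Proof.
move=> ab Pmono loc.
pose Q s := exists2 r : R, 0 < r & forall t : R, a <= t <= s -> P t r.
suff : Q b by [].
(* A radius valid up to [t0 - r / 2] meets the ball around [t0]; the half radius provides the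
   overlap. If [t0 - r / 2] lies left of [a], the first piece is empty and any [r0] serves, which
   explains the value 1 used below. *)
have glue t0 s r r0 : 0 < r -> (forall t : R, a <= t <= b -> `|t - t0| < r -> P t r) ->
    0 < r0 -> (forall t : R, a <= t <= t0 - r / 2 -> P t r0) ->
    s < t0 + r -> s <= b -> Q s.
  move=> rp Hr r0p Hr0 sr sb; exists (Num.min r r0); first by rewrite lt_min rp.
  move=> t /andP[at_ ts]; have [tl|tl] := leP t (t0 - r / 2).
    by apply: Pmono (Hr0 t _); rewrite ?lt_min ?rp ?r0p ?ge_min ?lexx ?orbT ?at_.
  apply: Pmono (Hr t _ _); rewrite ?lt_min ?rp ?r0p ?ge_min ?lexx ?orbT ?at_ //=; first by lra.
  by rewrite ltr_norml; lra.
apply: (@real_induction _ a b Q); last by rewrite ab lexx.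
- have [r r0 Hr] := loc a ltac:(lra).
  by apply: (glue a a r 1) => //; [move=> t; lra|lra].
- move=> t tab [r0 r0p Hr0]; have [r rp Hr] := loc t ltac:(lra).
  exists r => // s sr sb; apply: (glue t s r r0) => // [u us|]; last by lra.
  by apply: Hr0; lra.
- move=> t tab Qt; have [r rp Hr] := loc t ltac:(lra).
  have [ar|ra] := leP a (t - r / 2); last first.
    by apply: (glue t t r 1) => //; [move=> u; lra|lra|lra].
  have [r0 r0p Hr0] := Qt (t - r / 2) ltac:(lra).
  by apply: (glue t t r r0) => //; lra.
Qed.

(** A Gronwall inequality for right Dini derivatives with a bootstrap: the differential inequality
    is available only below [rho], and the exponential bound itself keeps [phi] below [rho]. It is
    proved by showing that [expR (- mu * t) * phi t] grows at most with an arbitrarily small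
    slope. *)
Lemma le_expR_growth (R : realType) (T mu rho : R) (phi : R -> R) :
  (forall t : R, 0 <= t <= T -> 0 <= phi t) ->
  expR (`|mu| * T) * phi 0 < rho ->
  (forall t : R, 0 < t <= T -> forall e : R, 0 < e -> exists2 d : R, 0 < d &
     forall s : R, 0 <= s < t -> t - s < d -> phi t <= phi s + e) ->
  (forall t : R, 0 <= t < T -> phi t <= rho -> forall e : R, 0 < e ->
     exists2 d : R, 0 < d &
       forall h : R, 0 < h < d -> t + h <= T ->
         phi (t + h) <= phi t + h * (mu * phi t + e)) ->
  forall t : R, 0 <= t <= T -> phi t <= expR (mu * t) * phi 0.
Proof.
move=> phi0 rho0 lc gr t0 t0T.
set E := expR (`|mu| * T) in rho0 *.
have T0 : 0 <= T by lra.
have E0 : 0 < E by apply: expR_gt0.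
have leE x t : 0 <= t <= T -> `|x| = `|mu| -> expR (x * t) <= E.
  move=> /andP[t0' tT] xmu; rewrite ler_expR; apply: le_trans (ler_norm _) _.
  by rewrite normrM xmu ler_wpM2l // ger0_norm.
pose psi t := expR (- mu * t) * phi t.
have psiK t : phi t = expR (mu * t) * psi t.
  by rewrite /psi mulrA -expRD mulNr subrr expR0 mul1r.
have psi_0 : psi 0 = phi 0 by rewrite /psi mulr0 expR0 mul1r.
suff : forall e : R, 0 < e -> psi t0 <= phi 0 + e.
  move=> /ler_addgt0Pr H; rewrite (psiK t0).
  by rewrite ler_pM2l // expR_gt0.
move=> e e0; pose gap := rho - E * phi 0.
have gap0 : 0 < gap by rewrite subr_gt0.
(* The first bound makes the total growth of [psi] at most [e]; the second one spends at most the
   gap between [E * phi 0] and [rho], so that the threshold is respected. *)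
pose eta := Num.min (e / (1 + T)) (gap / (E * (1 + T))).
have ET0 : 0 < E * (1 + T) by rewrite mulr_gt0 //; lra.
have T1 : 0 < 1 + T by lra.
have eta0 : 0 < eta by rewrite lt_min !divr_gt0.
have etae : eta * (1 + T) <= e by rewrite -ler_pdivlMr // ge_min lexx.
have etag : eta * (E * (1 + T)) <= gap by rewrite -ler_pdivlMr // ge_min lexx orbT.
suff /(_ t0 t0T) : forall t : R, 0 <= t <= T -> psi t <= psi 0 + eta * (t - 0).
  by rewrite psi_0; nra.
apply: le_linear_growth.
- move=> t tT e1 e10.
  have phit := phi0 t ltac:(lra).
  have [d d0 Hd] := lc t tT (e1 / 2 / E) ltac:(by rewrite !divr_gt0).
  have D0 : 0 < 1 + `|mu| * E * phi t by rewrite ltr_pwDl // !mulr_ge0 // ltW.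
  exists (Num.min d (e1 / 2 / (1 + `|mu| * E * phi t))).
    by rewrite lt_min d0 !divr_gt0.
  move=> s st; rewrite lt_min => /andP[sd]; rewrite ltr_pdivlMr // => se.
  have H := Hd s st sd.
  have Es : expR (- mu * s) <= E by apply: leE; rewrite ?normrN //; lra.
  have Et : expR (- mu * t) <= E by apply: leE; rewrite ?normrN //; lra.
  have H1 : expR (- mu * t) - expR (- mu * s) <= E * `|mu| * (t - s).
    have -> : expR (- mu * s) = expR (- mu * t) * expR (mu * (t - s)).
      by rewrite -expRD; congr expR; ring.
    have := expR_ge1Dx (mu * (t - s)).
    have := expR_gt0 (- mu * t); have := ler_norm (- mu); rewrite normrN.
    set x := expR _; set y := expR _ => mu1 x0 y1.
    have h1 : x * (1 - y) <= x * (- mu * (t - s)) by rewrite ler_pM2l //; lra.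
    have h2 : x * (- mu * (t - s)) <= x * (`|mu| * (t - s)).
      by rewrite ler_pM2l // ler_wpM2r //; lra.
    have h3 : x * (`|mu| * (t - s)) <= E * (`|mu| * (t - s)).
      by rewrite ler_wpM2r // mulr_ge0 //; lra.
    lra.
  have H2 : (expR (- mu * t) - expR (- mu * s)) * phi t <= E * `|mu| * (t - s) * phi t.
    by rewrite ler_wpM2r.
  have H3 : expR (- mu * s) * phi t <= expR (- mu * s) * (phi s + e1 / 2 / E).
    by rewrite ler_pM2l // expR_gt0.
  have H4 : expR (- mu * s) * (e1 / 2 / E) <= e1 / 2.
    by rewrite mulrA ler_pdivrMr // mulrC ler_pM2l //; lra.
  rewrite /psi; nra.
- move=> t tT; rewrite subr0 psi_0 => psit.
  have phirho : phi t <= rho.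
    have h1 := leE mu t ltac:(lra) erefl.
    have h2 : 0 <= phi 0 + eta * t by have := phi0 0 ltac:(lra); nra.
    have : phi t <= expR (mu * t) * (phi 0 + eta * t).
      by rewrite (psiK t) ler_pM2l // expR_gt0.
    have : expR (mu * t) * (phi 0 + eta * t) <= E * (phi 0 + eta * t) by rewrite ler_wpM2r.
    have : E * (eta * t) <= eta * (E * (1 + T)).
      by rewrite mulrCA !ler_pM2l //; lra.
    rewrite /gap in etag; lra.
  have [d d0 Hd] := gr t tT phirho (eta / E) ltac:(by rewrite divr_gt0).
  exists d => // h hd thT; have H := Hd h hd thT.
  rewrite /psi.
  (* The factor [1 + mu * h] of one step is dominated by [expR (mu * h)] for either sign of [mu];
     nonnegativity of [phi] allows multiplying by it. *)
  have -> : expR (- mu * t) = expR (- mu * (t + h)) * expR (mu * h).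
    by rewrite -expRD; congr expR; ring.
  have x0 := expR_gt0 (- mu * (t + h)).
  have xE : expR (- mu * (t + h)) <= E by apply: leE; rewrite ?normrN //; lra.
  have y1 := expR_ge1Dx (mu * h).
  move: (expR (- mu * (t + h))) (expR (mu * h)) x0 xE y1 => x y x0 xE y1.
  have h1 : x * phi (t + h) <= x * (phi t + h * (mu * phi t + eta / E)) by rewrite ler_pM2l.
  have h2 : x * (phi t * (1 + mu * h)) <= x * (phi t * y).
    by rewrite ler_pM2l // ler_wpM2l // phi0 //; lra.
  have h3 : x * (h * (eta / E)) <= eta * h.
    rewrite mulrCA mulrC ler_pM2r; last by lra.
    by rewrite mulrA ler_pdivrMr // mulrC ler_pM2l.
  lra.
Qed.

(** * Linear maps and operator norms *)

Section linear_operators.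
Variables (R : realType) (V W : normedModType R).
Implicit Type L : V -> W.

Lemma islinear0 L : islinear L -> L 0 = 0.
Proof. by move=> lin; have := lin (-1) 0 0; rewrite scaler0 addr0 scaleN1r addNr. Qed.

Lemma islinearZ L a v : islinear L -> L (a *: v) = a *: L v.
Proof. by move=> lin; have := lin a v 0; rewrite !addr0 islinear0 // addr0. Qed.

Lemma islinearD L u v : islinear L -> L (u + v) = L u + L v.
Proof. by move=> lin; have := lin 1 u v; rewrite !scale1r. Qed.

Lemma islinearB L u v : islinear L -> L (u - v) = L u - L v.
Proof. by move=> lin; rewrite islinearD // -scaleN1r islinearZ // scaleN1r. Qed.

Lemma islinear_sub (K L : V -> W) :
  islinear K -> islinear L -> islinear (fun v => K v - L v).
Proof. by move=> kl ll a u v; rewrite kl ll scalerBr opprD addrACA. Qed.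

Lemma islinear_le L (c : R) : islinear L ->
  (forall v, `|v| <= 1 -> `|L v| <= c) -> forall v, `|L v| <= c * `|v|.
Proof.
move=> lin Lc v; have [->|v0] := eqVneq v 0.
  by rewrite islinear0 // !normr0 mulr0.
have nv : 0 < `|v| by rewrite normr_gt0.
have -> : v = `|v| *: (`|v|^-1 *: v) by rewrite scalerA divff ?scale1r // gt_eqF.
rewrite islinearZ // normrZ normr_id normrZ normr_id mulrC.
have n1 : `|(`|v|^-1 *: v)| = 1 by rewrite normrZ normfV normr_id mulVf // gt_eqF.
rewrite normrZ normfV normr_id mulVf ?gt_eqF // mulr1 ler_pM2r //.
by apply: Lc; rewrite n1.
Qed.

Lemma opnorm_le L (c : R) : islinear L -> (opnorm L <= c%:E)%E ->
  forall v, `|L v| <= c * `|v|.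
Proof.
move=> lin Lc; apply: islinear_le => // v v1.
rewrite -lee_fin; apply: le_trans Lc.
by apply: ereal_sup_ubound; exists v.
Qed.

Lemma opnorm_ge0 L : islinear L -> (0 <= opnorm L)%E.
Proof.
move=> lin; apply: ereal_sup_ubound; exists 0; first by rewrite /= normr0.
by rewrite islinear0 // normr0.
Qed.

Lemma opnorm2_le (K : V -> V -> W) (c : R) :
  (forall v, islinear (K ^~ v)) -> (forall h, islinear (K h)) ->
  (opnorm2 K <= c%:E)%E -> forall h v, `|K h v| <= c * `|h| * `|v|.
Proof.
move=> lin1 lin2 Kc h v; rewrite mulrAC.
apply: (@islinear_le (K ^~ v) _ (lin1 v)) => {}h h1; apply: opnorm_le => //.
by apply: le_trans Kc; apply: ereal_sup_ubound; exists h.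
Qed.

End linear_operators.

(** * Limits with a rate and the one-sided derivative of the norm *)

(** The limit inherits the explicit rate with the same constant, so later passages to the limit are
    single inequalities closed by [le_of_inv_nat]. *)
Lemma seq_lim_bound (R : realType) (V : completeNormedModType R) (z : nat -> V)
    (c : R) :
  (forall n m, (n <= m)%N -> `|z n - z m| <= c / n.+1%:R) ->
  exists l, forall n, `|z n - l| <= c / n.+1%:R.
Proof.
move=> zc.
have c0 : 0 <= c.
  by have := zc 0%N 0%N (leqnn _); rewrite subrr normr0 divr1.
have : cvg (z @ \oo).
  apply: cauchy_cvg; apply: cauchy_exP => e e0.
  have [N HN] : exists N : nat, c / N.+1%:R < e.
    exists (Num.truncn (c / e)).
    by rewrite ltr_pdivrMr // mulrC -ltr_pdivrMr // truncnS_gt.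
  exists (z N); exists N => // m /= Nm.
  by rewrite -ball_normE /=; apply: le_lt_trans (zc _ _ Nm) HN.
set l := lim _ => zl; exists l => n.
have H : (fun m => `|z n - z m|) @ \oo --> `|z n - l|.
  by apply: cvg_norm; apply: cvgB => //; apply: cvg_cst.
apply: (@ler_cvg_to _ _ _ _ (fun m => `|z n - z m|) (fun=> c / n.+1%:R) _ _ H).
  exact: cvg_cst.
by exists n => // m /= nm; apply: zc.
Qed.

(** By convexity of the norm the difference quotient is nondecreasing in [h], and it is bounded
    below by minus the norm of [v]. This guarantees that the [lim] in [semi_ip] is a genuine limit
    and not a default value. *)
Lemma norm_slope_cvg (R : realType) (W : normedModType R) (u v : W) :
  cvg ((fun h : R => (`|u + h *: v| - `|u|) / h) @ at_right 0).
Proof.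
apply: nondecreasing_at_right_is_cvgr; near=> x.
  move=> h k; rewrite !in_itv /= => /andP[h0 hx] /andP[k0 kx] hk.
  rewrite ler_pdivrMr // mulrAC ler_pdivlMr // mulrC.
  (* For [h <= k] the point [u + h *: v] is a convex combination of [u] and [u + k *: v], written
     without division. *)
  have E : k *: (u + h *: v) = (k - h) *: u + h *: (u + k *: v).
    by rewrite !scalerDr addrA -scalerDl subrK !scalerA (mulrC h).
  have : k * `|u + h *: v| <= (k - h) * `|u| + h * `|u + k *: v|.
    have := ler_normD ((k - h) *: u) (h *: (u + k *: v)).
    by rewrite -E !normrZ (gtr0_norm h0) (gtr0_norm k0) ger0_norm ?subr_ge0.
  lra.
exists (- `|v|) => _ [h /= + <-]; rewrite in_itv /= => /andP[h0 hx].
rewrite ler_pdivlMr // mulNr lerNl opprB lerBlDr.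
rewrite -{1}(addrK (h *: v) u); apply: le_trans (ler_normB _ _) _.
by rewrite normrZ gtr0_norm // addrC mulrC.
Unshelve. all: by end_near. Qed.

(** Turns a bound on the semi-inner product into a first-order upper bound for the norm, which is
    the form that the Gronwall lemma consumes. *)
Lemma semi_ip_norm_growth (R : realType) (W : normedModType R) (u v : W) (l : R) :
  u != 0 -> semi_ip u v / `|u| ^+ 2 <= l ->
  forall e : R, 0 < e -> exists2 d : R, 0 < d &
    forall h : R, 0 < h < d -> `|u + h *: v| <= `|u| + h * (l * `|u| + e).
Proof.
move=> u0 sl e e0; have nu : 0 < `|u| by rewrite normr_gt0.
have := @norm_slope_cvg _ _ u v.
move: sl; rewrite /semi_ip; set L := lim _ => sl cv.
have Ll : L <= l * `|u|.
  by move: sl; rewrite ler_pdivrMr ?exprn_gt0 // expr2 mulrA mulrC ler_pM2r.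
have /cvgrPdist_le/(_ e e0) := cv; rewrite near_withinE => -[d /= d0 Hd].
exists d => // h /andP[h0 hd].
have := Hd h; rewrite /= sub0r normrN gtr0_norm // => /(_ hd h0).
rewrite -/L ler_distl => /andP[H _].
have {}H : (`|u + h *: v| - `|u|) / h <= l * `|u| + e by lra.
by move: H; rewrite ler_pdivrMr //; lra.
Qed.

(** * Strict differentiability of continuously differentiable maps *)

(** Mean value inequality on the straight segment between the two points, on which the derivative
    stays close to the one at [(t0, u0)]; times remain nonnegative by convexity. Since both points
    vary, this yields the local Lipschitz bound as well as linearizations with a radius uniform in
    the base point. *)
Lemma strict_differentiability (R : realType) (V : normedModType R)
    (f : R -> V -> V) (ft : R -> V -> V) (fu : R -> V -> V -> V) :
  hs_diff f ft fu -> hs_continuous ft (@dist_vec _ V) ->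
  hs_continuous fu (@dist_op _ V V) ->
  forall (t0 : R) (u0 : V), 0 <= t0 -> forall e : R, 0 < e -> exists2 r : R, 0 < r &
    forall (t : R) (u : V) (t' : R) (u' : V), 0 <= t -> 0 <= t' ->
      `|t - t0| < r -> `|t' - t0| < r -> `|u - u0| < r -> `|u' - u0| < r ->
      `|f t' u' - f t u - ((t' - t) *: ft t0 u0 + fu t0 u0 (u' - u))|
        <= e * (`|t' - t| + `|u' - u|).
Proof.
move=> fdiff ftc fuc t0 u0 t00 e e0.
have e20 : 0 < e / 2 by lra.
have [d1 d10 H1] := ftc t0 u0 t00 _ e20.
have [d2 d20 H2] := fuc t0 u0 t00 _ e20.
exists (Num.min d1 d2); first by rewrite lt_min d10.
move=> t u t' u' tp t'p; rewrite !lt_min.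
move=> /andP[t1 t2] /andP[t1' t2'] /andP[u1 u2] /andP[u1' u2'].
pose tau s := t + s * (t' - t); pose nu s := u + s *: (u' - u).
have conv (X : normedModType R) (x x' x0 : X) (d s : R) : 0 <= s <= 1 ->
    `|x - x0| < d -> `|x' - x0| < d -> `|x + s *: (x' - x) - x0| < d.
  move=> /andP[s0 s1] xd xd'.
  have -> : x + s *: (x' - x) - x0 = (1 - s) *: (x - x0) + s *: (x' - x0).
    rewrite (_ : x' - x = (x' - x0) - (x - x0)); last by rewrite opprB addrA subrK.
    by rewrite addrAC scalerBr scalerBl scale1r addrA addrAC.
  apply: le_lt_trans (ler_normD _ _) _; rewrite !normrZ !ger0_norm //; last by lra.
  have [->|s0'] := eqVneq s 0; first by lra.
  have : 0 < s by rewrite lt_neqAle eq_sym s0'.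
  by nra.
pose c := (t' - t) *: ft t0 u0 + fu t0 u0 (u' - u).
pose N := `|t' - t| + `|u' - u|.
have N0 : 0 <= N by rewrite addr_ge0.
have := @norm_sub_le_linear _ _ 0 1 (e * N) (fun s => f (tau s) (nu s)) c ler01.
rewrite /tau /nu !mul0r !mul1r !scale0r !scale1r !addr0 !subrKC subr0 mulr1 scale1r.
apply=> s s01 e3 e30.
have taup : 0 <= tau s by rewrite /tau; nra.
have N1 : 0 < 1 + N by lra.
have [lin_s [d d0 Hd]] : bounded_lin (fu (tau s) (nu s)) /\ exists2 d, 0 < d &
    forall (x : R) (h : V), 0 <= tau s + x -> `|x| < d -> `|h| < d ->
        `|f (tau s + x) (nu s + h) - f (tau s) (nu s)
           - (x *: ft (tau s) (nu s) + fu (tau s) (nu s) h)|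
          <= e3 / (1 + N) * (`|x| + `|h|).
  have [? H] := fdiff (tau s) (nu s) taup; split=> //.
  by have := H (e3 / (1 + N)); apply; rewrite divr_gt0.
exists (d / (1 + N)); first by rewrite divr_gt0.
move=> x sx; rewrite ltr_pdivlMr // => xd.
have := Hd (x * (t' - t)) (x *: (u' - u)).
rewrite /tau /nu -!addrA -mulrDl -scalerDl.
rewrite normrM normrZ -/(tau s) -/(nu s) -/(tau (s + x)) -/(nu (s + x)).
rewrite -mulrDr -/N.
have x0 := normr_ge0 x.
have tt0 := normr_ge0 (t' - t); have uu0 := normr_ge0 (u' - u).
have taux : 0 <= tau (s + x) by rewrite /tau; nra.
move=> /(_ taux); have l1 : `|x| * `|t' - t| < d by rewrite /N in xd; nra.
have l2 : `|x| * `|u' - u| < d by rewrite /N in xd; nra.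
move=> /(_ l1 l2).
have := H1 (tau s - t0) (nu s - u0).
have := H2 (tau s - t0) (nu s - u0).
rewrite !subrKC.
move=> /(_ taup (conv _ t t' t0 d2 s s01 t2 t2') (conv _ u u' u0 d2 s s01 u2 u2')) D2.
move=> /(_ taup (conv _ t t' t0 d1 s s01 t1 t1') (conv _ u u' u0 d1 s s01 u1 u1')).
rewrite /dist_vec lee_fin => D1 D3.
have D4 : `|fu (tau s) (nu s) (u' - u) - fu t0 u0 (u' - u)| <= e / 2 * `|u' - u|.
  apply: (opnorm_le _ D2); apply: islinear_sub; first by case: lin_s.
  by have [[]] := fdiff t0 u0 t00.
have D5 : e3 / (1 + N) * (`|x| * N) <= e3 * `|x|.
  rewrite mulrAC ler_pdivrMr // -mulrA ler_pM2l //; nra.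
move: D3; set F1 := f _ _; set F0 := f _ _; set A := ft (tau s) (nu s).
rewrite -scalerA (islinearZ _ _ (proj1 lin_s)) -scalerDr.
set B := fu _ _ _ in D4 *; move=> D3.
rewrite addrA in D3; rewrite addrA.
(* First the remainder of differentiability at the running point of the segment, charged to [e3];
   then the change of the derivative from that point to [(t0, u0)], charged to [e]. *)
have -> : F1 - F0 - x *: c = (F1 - F0 - x *: ((t' - t) *: A + B))
    + x *: ((t' - t) *: A + B - c) by rewrite scalerBr addrA subrK.
apply: le_trans (ler_normD _ _) _; rewrite normrZ mulrDl.
have -> : (t' - t) *: A + B - c = (t' - t) *: (A - ft t0 u0) + (B - fu t0 u0 (u' - u)).
  by rewrite /c opprD addrACA scalerBr.
have := ler_normD ((t' - t) *: (A - ft t0 u0)) (B - fu t0 u0 (u' - u)).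
rewrite normrZ => D6.
have D7 : `|t' - t| * `|A - ft t0 u0| <= `|t' - t| * (e / 2) by rewrite ler_wpM2l.
have D8 : `|x| * `|(t' - t) *: (A - ft t0 u0) + (B - fu t0 u0 (u' - u))| <= `|x| * (e * N).
  rewrite ler_wpM2l // /N; nra.
lra.
Qed.

(** * Existence of solutions in a tube by Euler polygons *)

Lemma le_of_inv_nat (R : realType) (x y c : R) :
  (forall n : nat, x <= y + c / n.+1%:R) -> x <= y.
Proof.
move=> H; apply/ler_addgt0Pr => e e0.
have N0 : 0 < (Num.truncn (`|c| / e)).+1%:R :> R by rewrite ltr0n.
apply: le_trans (H (Num.truncn (`|c| / e))) _; rewrite lerD2l ler_pdivrMr //.
apply: le_trans (ler_norm c) _; rewrite mulrC -ler_pdivrMr //.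
exact: ltW (truncnS_gt _).
Qed.

Section existence.
Variables (R : realType) (V : completeNormedModType R) (T r L : R).
Variables (g : R -> V -> V) (z0 : V).
Hypotheses (T0 : 0 <= T) (r0 : 0 < r) (L0 : 0 < L).
Hypothesis g_lip : forall (t t' : R) (z z' : V), 0 <= t <= T -> 0 <= t' <= T ->
  `|z| <= r -> `|z'| <= r -> `|g t z - g t' z'| <= L * (`|t - t'| + `|z - z'|).
Hypothesis g_le : forall (t : R) (z : V), 0 <= t <= T -> `|z| <= r ->
  `|g t z| <= L * `|z|.
Hypothesis z0r : expR (L * T) * `|z0| <= r.

(** A curve in the tube moves at speed at most [L * r], so [K] is a Lipschitz constant of the slope
    [g t (z t)] along it. *)
Let K := L * (1 + L * r).

Let K0 : 0 < K.
Proof. by rewrite mulr_gt0 // addr_gt0 // mulr_gt0. Qed.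

Let tube (t : R) (z : V) : t <= T -> `|z| <= expR (L * t) * `|z0| -> `|z| <= r.
Proof.
move=> tT /le_trans; apply; apply: le_trans z0r.
by rewrite ler_wpM2r // ler_expR ler_pM2l.
Qed.

(* Euler polygons. By Gronwall two of them are O(e)-close, so they converge as
   [e -> 0]; this avoids Picard iteration, which needs vector-valued integrals. *)
Definition approx_sol (e tau : R) (z : R -> V) : Prop :=
  [/\ z 0 = z0,
      forall t : R, 0 <= t <= tau -> `|z t| <= expR (L * t) * `|z0|,
      forall t t' : R, 0 <= t <= t' -> t' <= tau ->
        `|z t' - z t| <= L * r * (t' - t) &
      forall t t' : R, 0 <= t <= t' -> t' <= tau ->
        `|z t' - z t - (t' - t) *: g t (z t)| <= (t' - t) * (e + K * (t' - t))].

Lemma approx_sol_step (e tau tau' : R) (z : R -> V) : 0 < e ->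
  0 <= tau -> tau <= tau' <= T -> tau' <= tau + e / K ->
  approx_sol e tau z -> exists w, approx_sol e tau' w.
Proof.
move=> e0 tau0 /andP[ttau tauT] step [z_0 zb zl zd].
pose w t := if t <= tau then z t else z tau + (t - tau) *: g tau (z tau).
have wE t : t <= tau -> w t = z t by rewrite /w => ->.
have wE' t : tau <= t -> w t = z tau + (t - tau) *: g tau (z tau).
  rewrite le_eqVlt => /orP[/eqP <-|tt]; first by rewrite wE // subrr scale0r addr0.
  by rewrite /w leNgt tt.
have ztau := zb tau ltac:(lra).
have ztaur : `|z tau| <= r by apply: (tube _ ztau); lra.
have gtau : `|g tau (z tau)| <= L * `|z tau| by apply: g_le => //; lra.
have gr : `|g tau (z tau)| <= L * r by apply: le_trans gtau _; rewrite ler_pM2l.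
have wD t t' : tau <= t <= t' -> w t' - w t = (t' - t) *: g tau (z tau).
  move=> tt'; rewrite !wE'; [|lra|lra].
  rewrite opprD addrACA subrr add0r -scalerBl.
  by rewrite (_ : t' - tau - (t - tau) = t' - t) //; lra.
have wsplit t t' : t <= tau <= t' ->
    w t' - w t = (z tau - z t) + (t' - tau) *: g tau (z tau).
  by move=> /andP[h1 h2]; rewrite (wE _ h1) (wE' _ h2) addrAC.
have wb t : 0 <= t <= tau' -> `|w t| <= expR (L * t) * `|z0|.
  move=> /andP[t0 tt']; have [tt|tt] := leP t tau; first by rewrite wE ?zb ?t0.
  rewrite wE'; last exact: ltW.
  apply: le_trans (ler_normD _ _) _; rewrite normrZ ger0_norm; last by lra.
  have -> : L * t = L * (t - tau) + L * tau by ring.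
  rewrite expRD.
  have h1 := expR_ge1Dx (L * (t - tau)).
  have h2 : (t - tau) * `|g tau (z tau)| <= (t - tau) * (L * `|z tau|).
    by rewrite ler_wpM2l //; lra.
  have h3 : (1 + L * (t - tau)) * `|z tau| <= expR (L * (t - tau)) * `|z tau|.
    by rewrite ler_wpM2r.
  have h4 : expR (L * (t - tau)) * `|z tau| <= expR (L * (t - tau)) * (expR (L * tau) * `|z0|).
    by rewrite ler_pM2l ?expR_gt0.
  rewrite -mulrA; lra.
have wl t t' : 0 <= t <= t' -> t' <= tau' -> `|w t' - w t| <= L * r * (t' - t).
  move=> /andP[t0 tt'] t'tau; have [h|h] := leP t' tau.
    by rewrite !wE //; [apply: zl; lra|lra].
  have [h'|h'] := leP tau t.
    rewrite wD; last by lra.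
    rewrite normrZ ger0_norm; last by lra.
    by rewrite mulrC ler_wpM2r //; lra.
  rewrite wsplit; last by lra.
  apply: le_trans (ler_normD _ _) _; rewrite normrZ ger0_norm; last by lra.
  have h1 := zl t tau ltac:(lra) ltac:(lra).
  have : (t' - tau) * `|g tau (z tau)| <= (t' - tau) * (L * r) by rewrite ler_wpM2l //; lra.
  lra.
exists w; split=> //; first by rewrite wE.
have gw t : 0 <= t <= tau' -> `|g tau (z tau) - g t (w t)| <= K * `|t - tau|.
  move=> ttau'.
  have h1 : `|w tau - w t| <= L * r * `|t - tau|.
    have [h|h] := leP t tau.
      by rewrite ler0_norm ?opprB; [apply: wl; lra|lra].
    by rewrite distrC gtr0_norm; [apply: wl; lra|lra].
  rewrite wE // in h1; rewrite distrC.
  have -> : K * `|t - tau| = L * (`|t - tau| + L * r * `|t - tau|) by rewrite /K; ring.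
  apply: le_trans (g_lip _ _ _ _) _ => //; [lra|lra| |].
    by apply: tube (wb _ ttau'); lra.
  by rewrite ler_pM2l // lerD2l distrC.
move=> t t' /andP[t0 tt'] t'tau; have [h|h] := leP t' tau.
  by rewrite !wE //; [apply: zd; lra|lra].
have h1 := gw t ltac:(lra).
have [h'|h'] := leP tau t.
  rewrite wD; last by lra.
  rewrite -scalerBr normrZ ger0_norm; last by lra.
  apply: ler_wpM2l; first by lra.
  apply: le_trans h1 _; rewrite ger0_norm; last by lra.
  have : K * (t - tau) <= e by rewrite mulrC -ler_pdivlMr //; lra.
  have : 0 <= K * (t' - t) by rewrite mulr_ge0 ?subr_ge0 ?(ltW K0).
  lra.
rewrite wsplit; last by lra.
rewrite ltr0_norm ?opprB in h1; last by lra.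
have -> : z tau - z t + (t' - tau) *: g tau (z tau) - (t' - t) *: g t (w t) =
   (z tau - z t - (tau - t) *: g t (z t)) + (t' - tau) *: (g tau (z tau) - g t (w t)).
  rewrite wE; last exact: ltW.
  rewrite scalerBr addrACA -opprD -scalerDl.
  by rewrite (_ : tau - t + (t' - tau) = t' - t) //; lra.
apply: le_trans (ler_normD _ _) _; rewrite normrZ ger0_norm; last by lra.
have h2 := zd t tau ltac:(lra) ltac:(lra).
have h3 : (t' - tau) * `|g tau (z tau) - g t (w t)| <= (t' - tau) * (K * (tau - t)).
  by rewrite ler_wpM2l //; lra.
have h4 : 0 <= (t' - tau) * e by rewrite mulr_ge0 //; lra.
have h5 : K * ((tau - t) * (t' - t)) <= K * ((t' - t) * (t' - t)).
  rewrite ler_pM2l //; nra.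
lra.
Qed.

Lemma approx_sol_exists (e : R) : 0 < e -> exists z, approx_sol e T z.
Proof.
move=> e0.
have d0 : 0 < e / K by rewrite divr_gt0.
have H n : exists z, approx_sol e (Num.min (n%:R * (e / K)) T) z.
  elim: n => [|n [z Hz]].
    exists (fun=> z0); split=> // [t|t t'|t t'].
    - rewrite mul0r; move=> /andP[t0]; rewrite le_min => /andP[t0' _].
      rewrite (_ : t = 0) ?mulr0 ?expR0 ?mul1r //; lra.
    - move=> /andP[_ tt'] _; rewrite subrr normr0; apply: mulr_ge0; rewrite ?subr_ge0 //.
      by rewrite mulr_ge0 // ltW.
    - rewrite mul0r le_min => tt' /andP[t'0 _].
      have -> : t' = t by lra.
      by rewrite !subrr scale0r subrr normr0 mul0r.
  apply: approx_sol_step Hz => //.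
  - by rewrite le_min T0 mulr_ge0 // ltW.
  - apply/andP; split; last by rewrite ge_min lexx orbT.
    by rewrite le_min !ge_min lexx orbT andbT ler_pM2r // ler_nat leqnSn.
  - rewrite [in leRHS]/Num.min; case: ifP => _.
      by rewrite ge_min -natr1 mulrDl mul1r lexx.
    by rewrite ge_min; apply/orP; right; lra.
have [z Hz] := H (Num.truncn (T / (e / K))).+1; exists z.
move: Hz; rewrite min_r //.
by rewrite -ler_pdivrMr //; apply: ltW; apply: truncnS_gt.
Qed.

Lemma approx_sol_close (e e' : R) (z w : R -> V) : 0 < e' <= e ->
  approx_sol e T z -> approx_sol e' T w ->
  forall t : R, 0 <= t <= T -> `|z t - w t| <= expR (L * T) * 2 / L * e.
Proof.
move=> /andP[e'0 e'e] [z_0 zb zl zd] [w_0 wb wl wd].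
have e0 : 0 < e by lra.
have a0 : 0 < 2 * e / L by rewrite divr_gt0 // mulr_gt0.
(* The two defects add an inhomogeneous term of at most [2 * e] to the differential inequality;
   shifting by [2 * e / L] makes it homogeneous. The polygons lie in the tube by construction, so
   any threshold [rho] above the Gronwall bound will do. *)
pose phi t := `|z t - w t| + 2 * e / L.
have phi00 : phi 0 = 2 * e / L by rewrite /phi z_0 w_0 subrr normr0 add0r.
suff H t : 0 <= t <= T -> phi t <= expR (L * t) * phi 0.
  move=> t tT; have := H t tT; rewrite phi00 /phi.
  have : expR (L * t) * (2 * e / L) <= expR (L * T) * (2 * e / L).
    by rewrite ler_pM2r // ler_expR ler_pM2l //; lra.
  lra.
move: t; apply: (le_expR_growth (rho := expR (`|L| * T) * phi 0 + 1)).
- by move=> t _; rewrite addr_ge0 // ltW.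
- by rewrite ltrDl.
- move=> t tT e1 e10; have Lr0 : 0 < 2 * (L * r) by rewrite !mulr_gt0.
  exists (e1 / (2 * (L * r))); first by rewrite divr_gt0.
  move=> s st; rewrite ltr_pdivlMr // => ts.
  have h1 := zl s t ltac:(lra) ltac:(lra).
  have h2 := wl s t ltac:(lra) ltac:(lra).
  have E : z t - w t = (z s - w s) + ((z t - z s) - (w t - w s)).
    by rewrite -{1}(subrKC (z s) (z t)) -{1}(subrKC (w s) (w t)) opprD addrACA.
  have h3 := ler_normD (z s - w s) ((z t - z s) - (w t - w s)).
  have h4 := ler_normB (z t - z s) (w t - w s).
  rewrite -E in h3; rewrite /phi; lra.
- move=> t tT _ e1 e10.
  have K20 : 0 < 2 * K by apply: mulr_gt0 K0.
  exists (e1 / (2 * K)); first by rewrite divr_gt0.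
  move=> h /andP[h0]; rewrite ltr_pdivlMr // => hd thT.
  have h1 := zd t (t + h) ltac:(lra) ltac:(lra).
  have h2 := wd t (t + h) ltac:(lra) ltac:(lra).
  rewrite (addrC t) addrK (addrC h) in h1 h2.
  have h3 : `|g t (z t) - g t (w t)| <= L * `|z t - w t|.
    have := @g_lip t t (z t) (w t) ltac:(lra) ltac:(lra).
    rewrite subrr normr0 add0r; apply.
      by apply: (tube _ (zb t _)); lra.
    by apply: (tube _ (wb t _)); lra.
  set A := z (t + h) - z t - _ in h1; set B := w (t + h) - w t - _ in h2.
  have E : z (t + h) - w (t + h) = (z t - w t) + h *: (g t (z t) - g t (w t)) + (A - B).
    have AE : z (t + h) = z t + h *: g t (z t) + A by rewrite /A -(addrA _ (- z t)) -opprD subrKC.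
    have BE : w (t + h) = w t + h *: g t (w t) + B by rewrite /B -(addrA _ (- w t)) -opprD subrKC.
    by rewrite AE BE scalerBr !opprD addrACA [X in X + _]addrACA.
  have h4 := ler_normD ((z t - w t) + h *: (g t (z t) - g t (w t))) (A - B).
  have h5 := ler_normD (z t - w t) (h *: (g t (z t) - g t (w t))).
  have h6 := ler_normB A B.
  rewrite -E in h4; rewrite normrZ (gtr0_norm h0) in h5.
  have h7 : h * `|g t (z t) - g t (w t)| <= h * (L * `|z t - w t|) by rewrite ler_pM2l.
  have h8 : h * (2 * K * h) <= h * e1 by rewrite ler_pM2l //; lra.
  have h9 : h * e' <= h * e by rewrite ler_pM2l.
  rewrite /phi.
  have -> : L * (`|z t - w t| + 2 * e / L) = L * `|z t - w t| + 2 * e.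
    by rewrite mulrDr; congr (_ + _); rewrite mulrC divfK // gt_eqF.
  lra.
Qed.

(** In the limit the defect [e + K * (t' - t)] loses its first term, which leaves a quadratic
    remainder, uniform in time, with the slope taken at the left end of the interval. *)
Lemma tube_ode_exists : exists z : R -> V,
  [/\ z 0 = z0, forall t : R, 0 <= t <= T -> `|z t| <= r &
   exists2 M : R, 0 < M & forall t t' : R, 0 <= t <= t' -> t' <= T ->
     `|z t' - z t - (t' - t) *: g t (z t)| <= M * (t' - t) ^+ 2].
Proof.
have inv0 (n : nat) : 0 < n.+1%:R^-1 :> R by rewrite invr_gt0 ltr0n.
have /choice[zn Hzn] := fun n : nat => approx_sol_exists (inv0 n).
set c := expR (L * T) * 2 / L.
have /choice[z Hz] : forall t, exists l, 0 <= t <= T ->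
    forall n : nat, `|zn n t - l| <= c / n.+1%:R.
  move=> t; have [tT|] := boolP (0 <= t <= T); last by exists 0.
  have [n m nm|l Hl] := @seq_lim_bound _ V (zn^~ t) c; last by exists l.
  apply: approx_sol_close (Hzn n) (Hzn m) t tT.
  by rewrite inv0 lef_pV2 ?posrE ?ltr0n // ler_nat.
clearbody c; exists z; split.
- have : `|z 0 - z0| <= 0.
    apply: (@le_of_inv_nat _ _ _ c) => n; rewrite add0r.
    by have [<- _ _ _] := Hzn n; rewrite distrC Hz // lexx.
  by rewrite normr_le0 subr_eq0 => /eqP.
- move=> t tT; apply: (@le_of_inv_nat _ _ _ c) => n.
  have [_ zb _ _] := Hzn n.
  have h1 : `|zn n t| <= r by apply: (tube _ (zb t _)); lra.
  have := Hz t tT n; rewrite distrC => h2.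
  by rewrite -(subrKC (zn n t) (z t)); apply: le_trans (ler_normD _ _) (lerD h1 h2).
- exists K => // t t' /andP[t0 tt'] t'T.
  (* [T] accounts for the defect of the polygon, [2 * c] for the error at the two endpoints, and
     [T * (L * c)] for the error in the slope. *)
  apply: (@le_of_inv_nat _ _ _ (T + 2 * c + T * (L * c))) => n.
  have tT : 0 <= t <= T by lra.
  have t'T' : 0 <= t' <= T by lra.
  have [_ zb _ zd] := Hzn n.
  have zbr s : 0 <= s <= T -> `|z s| <= r.
    move=> sT; apply: (@le_of_inv_nat _ _ _ c) => m.
    have [_ zmb _ _] := Hzn m.
    have h1 : `|zn m s| <= r by apply: (tube _ (zmb s _)); lra.
    have := Hz s sT m; rewrite distrC => h2.
    by rewrite -(subrKC (zn m s) (z s)); apply: le_trans (ler_normD _ _) (lerD h1 h2).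
  have h0 := zd t t' ltac:(lra) t'T.
  have h1 := Hz t tT n; have h2 := Hz t' t'T' n.
  have h3 : `|g t (zn n t) - g t (z t)| <= L * `|zn n t - z t|.
    have := @g_lip t t (zn n t) (z t) tT tT.
    rewrite subrr normr0 add0r; apply; last exact: zbr.
    by apply: (tube _ (zb t _)); lra.
  have E : z t' - z t - (t' - t) *: g t (z t) =
      (zn n t' - zn n t - (t' - t) *: g t (zn n t)) +
      ((z t' - zn n t') - (z t - zn n t) - (t' - t) *: (g t (z t) - g t (zn n t))).
    rewrite -{1}(subrKC (zn n t') (z t')) -{1}(subrKC (zn n t) (z t)).
    rewrite -{1}(subrKC (g t (zn n t)) (g t (z t))) scalerDr !opprD.
    by rewrite [X in X + _ = _]addrACA [LHS]addrACA.
  rewrite E; apply: le_trans (ler_normD _ _) _.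
  set D := (z t' - zn n t') - (z t - zn n t) - _.
  have h4 : `|D| <= `|z t' - zn n t'| + `|z t - zn n t| + (t' - t) * `|g t (z t) - g t (zn n t)|.
    apply: le_trans (ler_normB _ _) _; rewrite normrZ ger0_norm; last by lra.
    by rewrite lerD2r ler_normB.
  rewrite distrC in h1; rewrite distrC in h2; rewrite distrC (distrC (zn n t)) in h3.
  have cn0 := le_trans (normr_ge0 _) h1.
  have h5 : (t' - t) * `|g t (z t) - g t (zn n t)| <= T * (L * (c / n.+1%:R)).
    apply: ler_pM => //; try lra.
    by apply: le_trans h3 _; rewrite ler_pM2l.
  have h6 : (t' - t) * n.+1%:R^-1 <= T * n.+1%:R^-1 by rewrite ler_pM2r //; lra.
  move: (n.+1%:R^-1) h0 h1 h2 h4 h5 h6 {cn0 inv0} => i h0 h1 h2 h4 h5 h6.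
  set Y := zn n t' - _ - _ in h0 *.
  have h7 : `|Y| <= (t' - t) * i + K * (t' - t) ^+ 2 by apply: le_trans h0 _; lra.
  have h8 : `|D| <= 2 * (c * i) + T * (L * (c * i)) by lra.
  have -> : (T + 2 * c + T * (L * c)) * i = T * i + (2 * (c * i) + T * (L * (c * i))) by ring.
  lra.
Qed.
End existence.

Lemma subr_split (X : zmodType) (a b a' b' : X) :
  a - b = (a' - b') + ((a - a') - (b - b')).
Proof. by rewrite -{1}(subrKC a' a) -{1}(subrKC b' b) opprD addrACA. Qed.

Lemma continuous_islinear_bounded (R : realType) (V W : normedModType R)
    (K : V -> W) :
  bounded_lin K -> exists2 c : R, 0 < c & forall v, `|K v| <= c * `|v|.
Proof.
move=> [lin cK].
have /cvgrPdist_le/(_ 1 ltr01) := cK 0; rewrite (islinear0 lin).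
rewrite near_nbhs => /nbhs_ballP[d /= d0 Hd].
exists (2 / d) => [|v]; first by rewrite divr_gt0.
have [->|v0] := eqVneq v 0; first by rewrite (islinear0 lin) !normr0 mulr0.
have nv : 0 < `|v| by rewrite normr_gt0.
pose a := d / 2 / `|v|.
have a0 : 0 < a by rewrite !divr_gt0.
have : ball 0 d (a *: v).
  rewrite -ball_normE /= sub0r normrN normrZ (gtr0_norm a0) divfK ?gt_eqF //; lra.
move=> /Hd /=; rewrite sub0r normrN (islinearZ _ _ lin) normrZ (gtr0_norm a0).
rewrite -ler_pdivlMl // mulr1 => /le_trans; apply.
by rewrite /a invf_div invf_div mulrC.
Qed.

(** * Solutions on a compact time interval and their uniform limits *)

(** The derivative is relative to [[0, T]], hence one-sided at both ends. The finite horizon is what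
    makes radii uniform in time, and intermediate solutions are known to exist only up to it. *)
Definition sol_on (R : realType) (V : normedModType R) (f : R -> V -> V) (T : R)
    (y : R -> V) : Prop :=
  forall t : R, 0 <= t <= T -> forall e : R, 0 < e -> exists2 d : R, 0 < d &
    forall s : R, 0 <= t + s <= T -> `|s| < d ->
      `|y (t + s) - y t - s *: f t (y t)| <= e * `|s|.

Lemma is_solution_sol_on (R : realType) (V : normedModType R) (f : R -> V -> V)
    (T : R) (u : R -> V) : is_solution f u -> sol_on f T u.
Proof.
move=> [u' [[uu' _] u'f]] t tT e e0.
have t0 : 0 <= t by lra.
have [d d0 Hd] := uu' t t0 e e0; exists d => // s sT sd.
by rewrite -u'f //; apply: Hd => //; lra.
Qed.

Section solutions.
Variables (R : realType) (V : normedModType R) (f : R -> V -> V) (T : R).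

Lemma sol_on_lipschitz_at (y : R -> V) : sol_on f T y ->
  forall t : R, 0 <= t <= T -> exists2 d : R, 0 < d &
    forall s : R, 0 <= s <= T -> `|s - t| < d ->
      `|y s - y t| <= (1 + `|f t (y t)|) * `|s - t|.
Proof.
move=> ysol t tT; have [d d0 Hd] := ysol t tT 1 ltr01.
exists d => // s sT sd.
have := Hd (s - t); rewrite subrKC mul1r => /(_ sT sd) H.
rewrite -(subrK ((s - t) *: f t (y t)) (y s - y t)).
apply: le_trans (ler_normD _ _) _; rewrite normrZ mulrDl mul1r (mulrC `|f _ _|).
by rewrite lerD2r.
Qed.

Lemma sol_on_continuous (y : R -> V) : sol_on f T y ->
  forall t : R, 0 <= t <= T -> forall e : R, 0 < e -> exists2 d : R, 0 < d &
    forall s : R, 0 <= s <= T -> `|s - t| < d -> `|y s - y t| < e.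
Proof.
move=> ysol t tT e e0; have [d d0 Hd] := sol_on_lipschitz_at ysol tT.
have B0 : 0 < 1 + `|f t (y t)| by rewrite ltr_pwDl.
exists (Num.min d (e / (1 + `|f t (y t)|))); first by rewrite lt_min d0 divr_gt0.
move=> s sT; rewrite lt_min ltr_pdivlMr // => /andP[sd se].
by apply: le_lt_trans (Hd s sT sd) _; rewrite mulrC.
Qed.

Lemma sol_on_mean_value (y : R -> V) (a b M : R) (c : V) : sol_on f T y ->
  0 <= a <= b -> b <= T ->
  (forall t : R, a <= t <= b -> `|f t (y t) - c| <= M) ->
  `|y b - y a - (b - a) *: c| <= M * (b - a).
Proof.
move=> ysol ab bT Hc; apply: norm_sub_le_linear; first by lra.
move=> t tab e e0; have [d d0 Hd] := ysol t ltac:(lra) e e0.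
exists d => // s tsab sd; have h1 := Hd s ltac:(lra) sd.
have -> : y (t + s) - y t - s *: c =
    y (t + s) - y t - s *: f t (y t) + s *: (f t (y t) - c).
  by rewrite scalerBr addrA subrK.
apply: le_trans (ler_normD _ _) _; rewrite normrZ mulrDl addrC.
by apply: lerD h1; rewrite mulrC ler_wpM2r // Hc.
Qed.

End solutions.

(** Replaces the passage to the limit in the integral equation: near [t] and for large [n] all
    slopes of [z n] are within [e] of the fixed vector [f t (x t)]. By the mean value inequality so
    are the increments, uniformly in [n], and this survives the limit. *)
Lemma sol_on_lim (R : realType) (V : normedModType R) (f : R -> V -> V)
    (T c : R) (z : nat -> R -> V) (x : R -> V) :
  (forall (t : R) (u : V), 0 <= t -> forall e : R, 0 < e -> exists2 d : R, 0 < d &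
    forall (t' : R) (u' : V), 0 <= t' -> `|t' - t| < d -> `|u' - u| < d ->
      `|f t' u' - f t u| <= e) ->
  (forall n, sol_on f T (z n)) ->
  (forall n (t : R), 0 <= t <= T -> `|z n t - x t| <= c / n.+1%:R) ->
  sol_on f T x.
Proof.
move=> fcont zsol zx t tT e e0.
have c0 : 0 <= c.
  by have := le_trans (normr_ge0 _) (zx 0%N t tT); rewrite divr1.
have small (d : R) : 0 < d -> exists N : nat, forall n, c / (n + N).+1%:R < d.
  move=> d0; exists (Num.truncn (c / d)) => n.
  rewrite ltr_pdivrMr ?ltr0n // mulrC -ltr_pdivrMr //.
  by apply: lt_le_trans (truncnS_gt _) _; rewrite ler_nat ltnS leq_addl.
have xcont (d : R) : 0 < d -> exists2 d' : R, 0 < d' &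
    forall s : R, 0 <= s <= T -> `|s - t| < d' -> `|x s - x t| < d.
  move=> d0; have d40 : 0 < d / 4 by lra.
  have [N /(_ 0%N) HN] := small _ d40.
  have [d' d'0 Hd'] := sol_on_continuous (zsol (0 + N)%N) tT d40.
  exists d' => // s sT sd; have h1 := Hd' s sT sd.
  have h2 := le_lt_trans (zx (0 + N)%N s sT) HN.
  have h3 := le_lt_trans (zx (0 + N)%N t tT) HN.
  have E : x s - x t = (z (0 + N)%N s - z (0 + N)%N t)
      + ((x s - z (0 + N)%N s) - (x t - z (0 + N)%N t)).
    exact: subr_split.
  rewrite distrC in h2; rewrite distrC in h3.
  have h4 := ler_normD (z (0 + N)%N s - z (0 + N)%N t)
    ((x s - z (0 + N)%N s) - (x t - z (0 + N)%N t)).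
  have h5 := ler_normB (x s - z (0 + N)%N s) (x t - z (0 + N)%N t).
  rewrite -E in h4; lra.
have t0 : 0 <= t by lra.
have [d d0 Hd] := fcont t (x t) t0 e e0.
have d20 : 0 < d / 2 by lra.
have [d1 d10 Hd1] := xcont _ d20; have [N HN] := small _ d20.
exists (Num.min d d1); first by rewrite lt_min d0.
move=> s tsT; rewrite lt_min => /andP[sd sd1].
have near n (r : R) : 0 <= r <= T -> `|r - t| <= `|s| ->
    `|f r (z (n + N)%N r) - f t (x t)| <= e.
  move=> rT rs; apply: Hd; [lra|exact: le_lt_trans sd|].
  have h1 := Hd1 r rT (le_lt_trans rs sd1).
  have h2 := le_lt_trans (zx (n + N)%N r rT) (HN n).
  rewrite -(subrK (x r) (z _ r)) -addrA; apply: le_lt_trans (ler_normD _ _) _.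
  lra.
have zs n : `|z (n + N)%N (t + s) - z (n + N)%N t - s *: f t (x t)| <= e * `|s|.
  have [s0|s0] := leP 0 s.
    have := @sol_on_mean_value _ _ f T (z (n + N)%N) t (t + s) e (f t (x t)) (zsol _).
    rewrite (addrC t) addrK (ger0_norm s0); apply; [lra|lra|].
    move=> r rts; apply: near; first by lra.
    by rewrite (ger0_norm s0) ger0_norm; lra.
  have := @sol_on_mean_value _ _ f T (z (n + N)%N) (t + s) t e (f t (x t)) (zsol _).
  rewrite opprD addrA subrr add0r (ltr0_norm s0) scaleNr opprK.
  rewrite -normrN opprD opprB => H; apply: H; [lra|lra|].
  move=> r rts; apply: near; first by lra.
  by rewrite (ltr0_norm s0) ler0_norm; lra.
apply: (@le_of_inv_nat _ _ _ (2 * c)) => n.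
have cn : c / (n + N).+1%:R <= c / n.+1%:R.
  by rewrite ler_wpM2l // lef_pV2 ?posrE ?ltr0n // ler_nat ltnS leq_addr.
have h1 := le_trans (zx (n + N)%N _ tsT) cn; have h2 := le_trans (zx (n + N)%N _ tT) cn.
have h3 := zs n.
rewrite distrC in h1; rewrite distrC in h2.
set y := z (n + N)%N in h1 h2 h3.
have -> : x (t + s) - x t - s *: f t (x t) = (y (t + s) - y t - s *: f t (x t))
    + ((x (t + s) - y (t + s)) - (x t - y t)).
  by rewrite (subr_split (x (t + s)) (x t) (y (t + s)) (y t)) addrAC.
apply: le_trans (ler_normD _ _) _.
have := ler_normB (x (t + s) - y (t + s)) (x t - y t).
rewrite -mulrA; move: (c / n.+1%:R) h1 h2 => q h1 h2 h4.
lra.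
Qed.

(** [f] is bounded along [x] by compactness of time; the bound is written [r^-1] because it weakens
    as [r] shrinks, as [uniform_radius] requires. *)
Lemma sol_on_lipschitz (R : realType) (V : normedModType R) (f : R -> V -> V)
    (T : R) (x : R -> V) : 0 <= T ->
  (forall (t : R) (u : V), 0 <= t -> forall e : R, 0 < e -> exists2 d : R, 0 < d &
    forall (t' : R) (u' : V), 0 <= t' -> `|t' - t| < d -> `|u' - u| < d ->
      `|f t' u' - f t u| <= e) ->
  sol_on f T x -> exists2 B : R, 0 < B &
    forall t t' : R, 0 <= t <= T -> 0 <= t' <= T -> `|x t - x t'| <= B * `|t - t'|.
Proof.
move=> T0 fcont xsol.
have [r r0 Hr] : exists2 r : R, 0 < r & forall t : R, 0 <= t <= T -> `|f t (x t)| <= r^-1.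
  apply: uniform_radius => // [t r r' /andP[r'0 r'r] /le_trans|t0 t0T].
    by apply; rewrite lef_pV2 ?posrE //; lra.
  have t00 : 0 <= t0 by lra.
  have [d d0 Hd] := fcont t0 (x t0) t00 1 ltr01.
  have [d1 d10 Hd1] := sol_on_continuous xsol t0T d0.
  have B0 : 0 < 1 + `|f t0 (x t0)| by rewrite ltr_pwDl.
  exists (Num.min (Num.min d d1) (1 + `|f t0 (x t0)|)^-1).
    by rewrite !lt_min d0 d10 invr_gt0.
  move=> t tT; rewrite !lt_min => /andP[/andP[td td1] _].
  apply: (@le_trans _ _ (1 + `|f t0 (x t0)|)).
    rewrite -lerBlDr; apply: le_trans (lerB_dist _ _) _; apply: Hd => //; first by lra.
    exact: Hd1.
  rewrite -[leLHS]invrK lef_pV2 ?posrE ?invr_gt0 ?lt_min ?d0 ?d10 ?invr_gt0 //.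
  by rewrite ge_min lexx orbT.
have ri0 : 0 < r^-1 by rewrite invr_gt0.
have H (t t' : R) : 0 <= t <= t' -> t' <= T -> `|x t' - x t| <= r^-1 * (t' - t).
  move=> tt' t'T; have := @sol_on_mean_value _ _ f T x t t' r^-1 0 xsol tt' t'T.
  rewrite scaler0 subr0; apply => s sT; rewrite subr0; apply: Hr; lra.
exists r^-1 => // t t' tT t'T; have [tt'|tt'] := leP t t'.
  by rewrite distrC (distrC t) ger0_norm ?subr_ge0 //; apply: H; lra.
by rewrite gtr0_norm ?subr_gt0 //; apply: H; lra.
Qed.

(** * Uniform estimates and existence in a tube around a solution *)

Section tube.
Variables (R : realType) (V : normedModType R).
Variables (f ft : R -> V -> V) (fu : R -> V -> V -> V) (T : R) (x : R -> V).
Hypotheses (T0 : 0 <= T) (fdiff : hs_diff f ft fu).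
Hypothesis ftc : hs_continuous ft (@dist_vec _ V).
Hypothesis fuc : hs_continuous fu (@dist_op _ V V).

Lemma hs_diff_lipschitz_at (t0 : R) (u0 : V) : 0 <= t0 ->
  exists2 L : R, 0 < L & exists2 r : R, 0 < r &
    forall (t : R) (u : V) (t' : R) (u' : V), 0 <= t -> 0 <= t' ->
      `|t - t0| < r -> `|t' - t0| < r -> `|u - u0| < r -> `|u' - u0| < r ->
      `|f t' u' - f t u| <= L * (`|t' - t| + `|u' - u|).
Proof.
move=> t00; have [lin _] := fdiff u0 t00.
have [c c0 Hc] := continuous_islinear_bounded lin.
have [r r0 Hr] := strict_differentiability fdiff ftc fuc u0 t00 ltr01.
exists (1 + `|ft t0 u0| + c); first by rewrite ltr_pwDr // addr_ge0.
exists r => // t u t' u' tp t'p h1 h2 h3 h4.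
have h := Hr t u t' u' tp t'p h1 h2 h3 h4.
set A := _ + fu _ _ _ in h; rewrite -(subrK A (f t' u' - f t u)).
apply: le_trans (ler_normD _ _) _.
have h5 := ler_normD ((t' - t) *: ft t0 u0) (fu t0 u0 (u' - u)).
rewrite -/A normrZ in h5.
have h6 := Hc (u' - u).
have h7 : 0 <= c * `|t' - t| by rewrite mulr_ge0 // ltW.
have h8 : 0 <= `|ft t0 u0| * `|u' - u| by rewrite mulr_ge0.
lra.
Qed.

Lemma hs_diff_continuous (t0 : R) (u0 : V) : 0 <= t0 ->
  forall e : R, 0 < e -> exists2 d : R, 0 < d &
    forall (t : R) (u : V), 0 <= t -> `|t - t0| < d -> `|u - u0| < d ->
      `|f t u - f t0 u0| <= e.
Proof.
move=> t00 e e0; have [L L0 [r r0 Hr]] := hs_diff_lipschitz_at u0 t00.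
have L20 : 0 < 2 * L by lra.
exists (Num.min r (e / (2 * L))); first by rewrite lt_min r0 divr_gt0.
move=> t u tp; rewrite !lt_min !ltr_pdivlMr // => /andP[t1 t2] /andP[u1 u2].
apply: le_trans (Hr t0 u0 t u t00 tp _ t1 _ u1) _; rewrite ?subrr ?normr0 //; lra.
Qed.

Hypothesis xsol : sol_on f T x.

(* [r] serves as radius and as inverse Lipschitz constant, so that the property is
   monotone in one parameter and [uniform_radius] applies. *)
Lemma tube_lipschitz : exists2 r : R, 0 < r &
  forall t t' : R, 0 <= t <= T -> 0 <= t' <= T -> `|t' - t| < r ->
  forall z z' : V, `|z| <= r -> `|z'| <= r ->
    `|f t (x t + z) - f t' (x t' + z')| <= r^-1 * (`|t - t'| + `|z - z'|).
Proof.
have [B B0 HB] := sol_on_lipschitz T0 hs_diff_continuous xsol.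
pose P t r := forall t' : R, 0 <= t' <= T -> `|t' - t| < r ->
  forall z z' : V, `|z| <= r -> `|z'| <= r ->
    `|f t (x t + z) - f t' (x t' + z')| <= r^-1 * (`|t - t'| + `|z - z'|).
have : exists2 r : R, 0 < r & forall t : R, 0 <= t <= T -> P t r.
  apply: uniform_radius => // [t r r' /andP[r'0 r'r] Pr t' t'T tt' z z' zr zr'|t0 t0T].
    apply: le_trans (Pr t' t'T (lt_le_trans tt' r'r) z z' (le_trans zr r'r) (le_trans zr' r'r)) _.
    by rewrite ler_wpM2r ?addr_ge0 // lef_pV2 ?posrE //; lra.
  have t00 : 0 <= t0 by lra.
  have [L L0 [r r0 Hr]] := hs_diff_lipschitz_at (x t0) t00.
  have r20 : 0 < r / 2 by lra.
  have [d d0 Hd] := sol_on_continuous xsol t0T r20.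
  have LB0 : 0 < L * (1 + B) by rewrite mulr_gt0 //; lra.
  pose q := Num.min (Num.min (d / 2) (r / 3)) (L * (1 + B))^-1.
  have q0 : 0 < q by rewrite !lt_min !divr_gt0 ?invr_gt0.
  have qd : q <= d / 2 by rewrite !ge_min lexx.
  have qr : q <= r / 3 by rewrite !ge_min lexx orbT.
  have qL : L * (1 + B) <= q^-1.
    by rewrite -[leLHS]invrK lef_pV2 ?posrE ?invr_gt0 // !ge_min lexx orbT.
  exists q => // t tT tq t' t'T tt' z z' zq zq'.
  have t't0 : `|t' - t0| < q + q.
    by rewrite -(subrK t t') -addrA; apply: le_lt_trans (ler_normD _ _) _; lra.
  have h1 := Hd t tT ltac:(lra); have h2 := Hd t' t'T ltac:(lra).
  have u1 : `|x t + z - x t0| < r.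
    by rewrite addrAC; apply: le_lt_trans (ler_normD _ _) _; lra.
  have u2 : `|x t' + z' - x t0| < r.
    by rewrite addrAC; apply: le_lt_trans (ler_normD _ _) _; lra.
  have h3 := Hr t' (x t' + z') t (x t + z) ltac:(lra) ltac:(lra) ltac:(lra) ltac:(lra) u2 u1.
  have h4 : `|x t + z - (x t' + z')| <= B * `|t - t'| + `|z - z'|.
    rewrite opprD addrACA; apply: le_trans (ler_normD _ _) _.
    by rewrite lerD2r HB.
  have h5 : L * (`|t - t'| + `|x t + z - (x t' + z')|) <=
      L * (`|t - t'| + (B * `|t - t'| + `|z - z'|)).
    by rewrite ler_pM2l // lerD2l.
  have h6 : L * (1 + B) * (`|t - t'| + `|z - z'|) <= q^-1 * (`|t - t'| + `|z - z'|).
    by rewrite ler_wpM2r // addr_ge0.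
  have h7 : 0 <= L * (B * `|z - z'|) by rewrite !mulr_ge0 // ltW.
  lra.
move=> [r r0 Pr]; exists r => // t t' tT t'T tt' z z' zr zr'; exact: Pr.
Qed.

(** Differentiability at each [x t] alone would give radii without a common lower bound. Strict
    differentiability at [(t0, x t0)] covers all nearby times with a frozen derivative, and
    continuity of [fu] moves the derivative to [(t, x t)]; each costs [e / 2]. *)
Lemma tube_differentiable (e : R) : 0 < e -> exists2 r : R, 0 < r &
  forall t : R, 0 <= t <= T -> forall z : V, `|z| <= r ->
    `|f t (x t + z) - f t (x t) - fu t (x t) z| <= e * `|z|.
Proof.
move=> e0.
apply: uniform_radius => // [t r r' /andP[r'0 r'r] Pr z zr'|t0 t0T].
  by apply: Pr; exact: le_trans r'r.
have t00 : 0 <= t0 by lra.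
have e20 : 0 < e / 2 by lra.
have [r r0 Hr] := strict_differentiability fdiff ftc fuc (x t0) t00 e20.
have [r1 r10 Hr1] := fuc (x t0) t00 e20.
have rr0 : 0 < Num.min (r / 2) r1 by rewrite lt_min r10 divr_gt0.
have [d d0 Hd] := sol_on_continuous xsol t0T rr0.
exists (Num.min (Num.min d r1) (r / 2)); first by rewrite !lt_min d0 r10 divr_gt0.
move=> t tT; rewrite !lt_min => /andP[/andP[td tr1] tr] z.
rewrite !le_min => /andP[/andP[zd zr1] zr].
have := Hd t tT td; rewrite lt_min => /andP[x1 x2].
have u1 : `|x t + z - x t0| < r.
  by rewrite addrAC; apply: le_lt_trans (ler_normD _ _) _; lra.
have h1 := Hr t (x t) t (x t + z) ltac:(lra) ltac:(lra) ltac:(lra) ltac:(lra) ltac:(lra) u1.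
rewrite subrr scale0r normr0 !add0r (addrC (x t)) addrK in h1.
have := Hr1 (t - t0) (x t - x t0); rewrite !subrKC => /(_ ltac:(lra) tr1 x2) h2.
have tp : 0 <= t by lra.
have [[lin1 _] _] := fdiff (x t) tp; have [[lin0 _] _] := fdiff (x t0) t00.
have h3 := opnorm_le (islinear_sub lin1 lin0) h2 z.
rewrite distrC in h3.
rewrite (addrC z) in h1.
have -> : f t (x t + z) - f t (x t) - fu t (x t) z =
    (f t (x t + z) - f t (x t) - fu t0 (x t0) z) + (fu t0 (x t0) z - fu t (x t) z).
  by rewrite addrA subrK.
apply: le_trans (ler_normD _ _) _; lra.
Qed.

End tube.

(** With [y = x + z] the equation becomes [z' = g(t, z)], where [g] vanishes at [z = 0] and is
    Lipschitz in the tube. Small data then stay small up to [T], so the existence is not merely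
    local in time. *)
Lemma sol_on_exists_near (R : realType) (V : completeNormedModType R)
    (f ft : R -> V -> V) (fu : R -> V -> V -> V) (T : R) (x : R -> V) :
  0 <= T -> hs_diff f ft fu -> hs_continuous ft (@dist_vec _ V) ->
  hs_continuous fu (@dist_op _ V V) -> sol_on f T x ->
  exists2 d : R, 0 < d & forall p : V, `|p - x 0| < d ->
    exists2 y, sol_on f T y & y 0 = p.
Proof.
move=> T0 fdiff ftc fuc xsol.
have [r r0 Hr] := tube_lipschitz T0 fdiff ftc fuc xsol.
(* The tube estimate holds only for times closer than [r], where [g] is a difference of two terms
   with constant [r^-1]. For times further apart each of the two values of [g] is at most 1, hence
   at most [r^-1] times the time difference. *)
pose L := 2 / r.
have L0 : 0 < L by rewrite divr_gt0.
have LE : L = r^-1 + r^-1 by rewrite /L mulr_natl mulr2n.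
have ri0 : 0 < r^-1 by rewrite invr_gt0.
have rr : r^-1 * r = 1 by rewrite mulVf // gt_eqF.
pose g t z := f t (x t + z) - f t (x t).
have g_lip0 (t : R) z z' : 0 <= t <= T -> `|z| <= r -> `|z'| <= r ->
    `|g t z - g t z'| <= r^-1 * `|z - z'|.
  move=> tT zr zr'; rewrite /g opprB addrA subrK.
  have := Hr t t tT tT _ z z' zr zr'.
  by rewrite !subrr normr0 add0r; apply.
have g0 t : g t 0 = 0 by rewrite /g addr0 subrr.
have g_le (t : R) z : 0 <= t <= T -> `|z| <= r -> `|g t z| <= r^-1 * `|z|.
  move=> tT zr; have := g_lip0 t z 0 tT zr; rewrite g0 !subr0 normr0.
  by apply; exact: ltW.
have g_leL (t : R) z : 0 <= t <= T -> `|z| <= r -> `|g t z| <= L * `|z|.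
  move=> tT zr; apply: le_trans (g_le t z tT zr) _.
  by rewrite ler_wpM2r // LE lerDl ltW.
have g_lip (t t' : R) z z' : 0 <= t <= T -> 0 <= t' <= T -> `|z| <= r -> `|z'| <= r ->
    `|g t z - g t' z'| <= L * (`|t - t'| + `|z - z'|).
  move=> tT t'T zr zr'; have [tt'|tt'] := ltP `|t' - t| r.
    have h1 := Hr t t' tT t'T tt' z z' zr zr'.
    have := Hr t t' tT t'T tt' 0 0; rewrite normr0 subrr normr0 !addr0.
    move=> /(_ (ltW r0) (ltW r0)) h2.
    have -> : g t z - g t' z' =
        (f t (x t + z) - f t' (x t' + z')) - (f t (x t) - f t' (x t')).
      by rewrite /g !opprD addrACA.
    apply: le_trans (ler_normB _ _) _; rewrite LE.
    have : 0 <= r^-1 * `|z - z'| by rewrite mulr_ge0 // ltW.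
    lra.
  have h1 := g_le t z tT zr; have h2 := g_le t' z' t'T zr'.
  have h3 : r^-1 * `|z| <= 1 by rewrite -rr ler_pM2l.
  have h4 : r^-1 * `|z'| <= 1 by rewrite -rr ler_pM2l.
  have h5 : 1 <= r^-1 * `|t - t'| by rewrite -rr ler_pM2l // distrC.
  have h6 : 0 <= r^-1 * `|z - z'| by rewrite mulr_ge0 // ltW.
  apply: le_trans (ler_normB _ _) _; rewrite LE; lra.
have gE t z : g t z = f t (x t + z) - f t (x t) by [].
(* The exponential growth bound with rate [L] then keeps [z] within radius [r] up to time [T]. *)
clearbody g; exists (r / expR (L * T)); first by rewrite divr_gt0 ?expR_gt0.
move=> p; rewrite ltr_pdivlMr ?expR_gt0 // mulrC => /ltW pr.
have [z [z_0 zr [M M0 zM]]] := tube_ode_exists T0 r0 L0 g_lip g_leL pr.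
exists (fun t => x t + z t); last by rewrite z_0 subrKC.
(* For negative [s] the quadratic estimate has its slope at [t + s]. Moving the slope to [t] costs
   [- s] times a change of [g] that is of order [- s], so the remainder stays quadratic. *)
have [M' M'0 zM'] : exists2 M' : R, 0 < M' & forall t s : R, 0 <= t <= T ->
    0 <= t + s <= T -> `|z (t + s) - z t - s *: g t (z t)| <= M' * `|s| ^+ 2.
  exists (M + L * (1 + M * T + L * r)).
    have : 0 <= M * T by rewrite mulr_ge0 // ltW.
    have : 0 < L * r by rewrite mulr_gt0.
    have := M0; move=> *; apply: addr_gt0 => //; apply: mulr_gt0 => //; lra.
  have c0 : 0 <= L * (1 + M * T + L * r).
    apply: mulr_ge0; first exact: ltW.
    by rewrite !addr_ge0 // mulr_ge0 // ltW.
  move=> t s tT tsT; have [s0|s0] := leP 0 s.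
    have := zM t (t + s) ltac:(lra) ltac:(lra).
    rewrite (addrC t) addrK (ger0_norm s0) => /le_trans; apply.
    by rewrite ler_wpM2r ?exprn_ge0 // lerDl.
  have := zM (t + s) t ltac:(lra) ltac:(lra).
  rewrite opprD addrA subrr add0r (ltr0_norm s0).
  have -> : (- s) ^+ 2 = s ^+ 2 by rewrite sqrrN.
  set t' := t + s in tsT *; set D := z t - z t' - _ => hD.
  have g1 : `|g t' (z t')| <= L * r.
    by apply: le_trans (g_leL _ _ tsT (zr _ tsT)) _; rewrite ler_pM2l // zr.
  have sT : - s <= T by rewrite /t' in tsT; lra.
  have h1 : `|z t' - z t| <= M * s ^+ 2 + (- s) * (L * r).
    rewrite distrC -(subrK (- s *: g t' (z t')) (z t - z t')).
    apply: le_trans (ler_normD _ _) _; apply: lerD => //.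
    by rewrite normrZ gtr0_norm ?oppr_gt0 // ler_wpM2l // oppr_ge0 ltW.
  have h2 := g_lip t' t (z t') (z t) tsT tT (zr _ tsT) (zr _ tT).
  have ts : `|t' - t| = - s by rewrite /t' addrAC subrr add0r ltr0_norm.
  rewrite ts in h2.
  have E : z t' - z t - s *: g t (z t) = - D + s *: (g t' (z t') - g t (z t)).
    rewrite /D !opprB scaleNr scalerBr.
    by rewrite (addrC (- (s *: g t' _))) addrA subrK.
  rewrite E; apply: le_trans (ler_normD _ _) _.
  rewrite normrN normrZ (ltr0_norm s0).
  have h3 : (- s) * `|g t' (z t') - g t (z t)| <=
      (- s) * (L * (- s + (M * s ^+ 2 + (- s) * (L * r)))).
    rewrite ler_wpM2l //; first by lra.
    by apply: le_trans h2 _; rewrite ler_pM2l // lerD2l.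
  have h4 : M * s ^+ 2 <= M * T * (- s).
    rewrite -mulrA ler_pM2l // expr2 -mulrNN ler_wpM2r //; lra.
  have h5 : L * (- s) * (M * s ^+ 2) <= L * (- s) * (M * T * (- s)).
    by rewrite ler_wpM2l // mulr_ge0 //; lra.
  lra.
move=> t tT e e0; have e20 : 0 < e / 2 by lra.
have [d d0 Hd] := xsol t tT _ e20.
exists (Num.min d (e / 2 / M')); first by rewrite lt_min d0 divr_gt0.
move=> s tsT; rewrite lt_min ltr_pdivlMr // => /andP[sd sM].
have -> : x (t + s) + z (t + s) - (x t + z t) - s *: f t (x t + z t) =
   (x (t + s) - x t - s *: f t (x t)) + (z (t + s) - z t - s *: g t (z t)).
  rewrite opprD addrACA [RHS]addrACA; congr (_ + _).
  by rewrite gE scalerBr opprB addKr.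
have h1 := Hd s tsT sd; have h2 := zM' t s tT tsT.
have h3 : M' * `|s| ^+ 2 <= e / 2 * `|s|.
  by rewrite expr2 mulrA ler_wpM2r // mulrC ltW.
apply: le_trans (ler_normD _ _) _; lra.
Qed.

(** * The transported difference and its local contraction *)

Section transport.
Variables (R : realType) (V W : normedModType R).
Variables (f : R -> V -> V) (Th Tht : R -> V -> V -> W).
Variables (Thu : R -> V -> V -> V -> W) (T C : R) (x y : R -> V).
Hypothesis Thdiff : hs_diff_op Th Tht Thu.
Hypothesis Thlin : forall (t : R) (u : V), 0 <= t -> islinear (Th t u).
Hypothesis Thle : forall (t : R) (u v : V), 0 <= t -> `|Th t u v| <= C * `|v|.
Hypotheses (C0 : 0 <= C) (xsol : sol_on f T x) (ysol : sol_on f T y).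

Lemma hs_diff_op_bound (t : R) (u : V) : 0 <= t ->
  (exists2 c : R, 0 <= c & forall h v : V, `|Thu t u h v| <= c * `|h| * `|v|) /\
  forall e : R, 0 < e -> exists2 d : R, 0 < d &
    forall (s : R) (h : V), 0 <= t + s -> `|s| < d -> `|h| < d -> forall v : V,
      `|Th (t + s) (u + h) v - Th t u v - (s *: Tht t u v + Thu t u h v)|
        <= e * (`|s| + `|h|) * `|v|.
Proof.
move=> t0; have [[Htl _] [Hu1 [Hu2 [Hfin Hd]]]] := Thdiff u t0.
have lin1 v : islinear (Thu t u ^~ v) by move=> a h1 h2; exact: Hu1.
have lin2 h : islinear (Thu t u h) by have [] := Hu2 h.
split.
  have fin : opnorm2 (Thu t u) \is a fin_num.
    rewrite ge0_fin_numE //; apply: le_trans (opnorm_ge0 (lin2 0)) _.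
    by apply: ereal_sup_ubound; exists 0 => //=; rewrite normr0.
  exists (fine (opnorm2 (Thu t u))).
    apply: fine_ge0; apply: le_trans (opnorm_ge0 (lin2 0)) _.
    by apply: ereal_sup_ubound; exists 0 => //=; rewrite normr0.
  by apply: opnorm2_le => //; rewrite fineK.
move=> e e0; have [d d0 H] := Hd e e0; exists d => // s h ts sd hd.
apply: opnorm_le (H s h ts sd hd).
apply: islinear_sub; first by apply: islinear_sub; exact: Thlin.
move=> a v w; rewrite Htl lin2 !scalerDr addrACA.
by rewrite !scalerA mulrC.
Qed.

(** A product and chain rule for an operator along [x] applied to [y - x]. The exact difference of
    [f] is kept here; replacing it by the linearization, which produces [Gop], is left to the
    contraction estimate. *)
Lemma transport_derivative (t : R) : 0 <= t <= T ->
  forall e : R, 0 < e -> exists2 d : R, 0 < d &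
    forall s : R, 0 <= t + s <= T -> `|s| < d ->
      `|Th (t + s) (x (t + s)) (y (t + s) - x (t + s)) - Th t (x t) (y t - x t)
        - s *: (Tht t (x t) (y t - x t) + Thu t (x t) (f t (x t)) (y t - x t)
                + Th t (x t) (f t (y t) - f t (x t)))| <= e * `|s|.
Proof.
move=> tT e e0; have t0 : 0 <= t by lra.
have [[c c0 Hc] Hd] := hs_diff_op_bound (x t) t0.
set v := y t - x t; set k := f t (y t) - f t (x t).
have [_ [Hu1 _]] := Thdiff (x t) t0.
pose Lx := 1 + `|f t (x t)|.
have Lx0 : 0 < Lx by rewrite ltr_pwDl.
(* [e1] is the precision required of the derivatives of [x] and [y], [e2] that of the derivative of
   [Th], and [B] below bounds the rate at which [Th (t + s) (x (t + s)) k] moves away from its value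
   at [s = 0]. *)
pose e1 := e / 4 / (1 + 2 * C + c * `|v|).
have D1 : 0 < 1 + 2 * C + c * `|v|.
  by rewrite -addrA ltr_pwDl // addr_ge0 // mulr_ge0.
have e10 : 0 < e1 by rewrite !divr_gt0.
pose e2 := e / 4 / (1 + (1 + Lx) * `|v|).
have D2 : 0 < 1 + (1 + Lx) * `|v| by rewrite ltr_pwDl // mulr_ge0 // addr_ge0 // ltW.
have e20 : 0 < e2 by rewrite !divr_gt0.
pose B := `|Tht t (x t) k| + c * Lx * `|k| + (1 + Lx) * `|k|.
have B0 : 0 < 1 + B.
  rewrite ltr_pwDl // !addr_ge0 // ?mulr_ge0 //; first exact: ltW.
  by rewrite addr_ge0 // ltW.
have [d1 d10 H1] := xsol tT e10; have [d2 d20 H2] := ysol tT e10.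
have [d3 d30 H3] := Hd _ e20; have [d4 d40 H4] := Hd 1 ltr01.
have [d5 d50 H5] := sol_on_lipschitz_at xsol tT.
pose dh := Num.min d3 d4.
have dh0 : 0 < dh by rewrite lt_min d30.
have [d6 d60 H6] := sol_on_continuous xsol tT dh0.
exists (Num.min (Num.min (Num.min d1 d2) (Num.min d5 d6)) (Num.min dh (e / 4 / (1 + B)))).
  by rewrite !lt_min d10 d20 d50 d60 d30 d40 !divr_gt0.
move=> s tsT; rewrite !lt_min ltr_pdivlMr //.
move=> /andP[/andP[/andP[s1 s2] /andP[s5 s6]] /andP[/andP[s3 s4] sB]].
have ts0 : 0 <= t + s by case/andP: tsT.
set h := x (t + s) - x t.
have hE : x (t + s) = x t + h by rewrite subrKC.
have := H5 (t + s) tsT; have := H6 (t + s) tsT; rewrite (addrC t) addrK (addrC s).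
move=> /(_ s6); rewrite -/h lt_min => /andP[h3 h4] /(_ s5) hL.
have T1 := H3 s h ts0 s3 h3 v; have T2 := H4 s h ts0 s4 h4 k.
have X1 := H1 s tsT s1; have Y1 := H2 s tsT s2.
rewrite -hE in T1 T2.
set v' := y (t + s) - x (t + s); set Th' := Th (t + s) (x (t + s)).
have V1 : `|v' - v - s *: k| <= 2 * e1 * `|s|.
  have -> : v' - v - s *: k = (y (t + s) - y t - s *: f t (y t))
      - (x (t + s) - x t - s *: f t (x t)).
    rewrite /v' /v /k scalerBr !opprD.
    by rewrite [X in X + _ = _]addrACA [LHS]addrACA.
  by apply: le_trans (ler_normB _ _) _; rewrite -mulrA mulr_natl mulr2n lerD.
have Z1 : `|h - s *: f t (x t)| <= e1 * `|s| by exact: X1.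
have TB := Thle (x (t + s)) (v' - v - s *: k) ts0.
have linT' : islinear Th' by exact: Thlin.
have TE : Th' (v' - v - s *: k) = Th' v' - Th' v - s *: Th' k.
  by rewrite (islinearB (v' - v) _ linT') (islinearB v' v linT') (islinearZ _ _ linT').
have UE : Thu t (x t) (h - s *: f t (x t)) v =
    Thu t (x t) h v - s *: Thu t (x t) (f t (x t)) v.
  by rewrite addrC -scaleNr Hu1 scaleNr addrC.
have UB := Hc (h - s *: f t (x t)) v.
set a := Th t (x t) v in T1 *; set b := Th t (x t) k in T2 *.
set p := Tht t (x t) v in T1 *; set q := Thu t (x t) (f t (x t)) v in UE *.
rewrite -/Th' in T1 T2 TB.
(* The four errors: differentiating [y - x], freezing the operator acting on [k], differentiating
   the operator acting on [v], and replacing the increment [h] of [x] by [s *: f t (x t)]. *)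
have -> : Th' v' - a - s *: (p + q + b) = Th' (v' - v - s *: k) + s *: (Th' k - b)
   + (Th' v - a - (s *: p + Thu t (x t) h v))
   + Thu t (x t) (h - s *: f t (x t)) v.
  rewrite TE UE scalerBr !scalerDr [X in _ = X + _ + _]addrA subrK.
  rewrite (addrAC (Th' v') (- Th' v)) -[X in _ = _ + X + _]addrA.
  rewrite [X in _ = X + _]addrA subrK !opprD !addrA subrK.
  by rewrite !(addrAC _ (- (s *: b))).
have K1 : `|Th' k - b| <= B * `|s|.
  rewrite -(subrK (s *: Tht t (x t) k + Thu t (x t) h k) (Th' k - b)).
  apply: le_trans (ler_normD _ _) _.
  have := ler_normD (s *: Tht t (x t) k) (Thu t (x t) h k); rewrite normrZ.
  have := Hc h k.
  have : c * `|h| * `|k| <= c * (Lx * `|s|) * `|k| by rewrite ler_wpM2r // ler_wpM2l.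
  have : (`|s| + `|h|) * `|k| <= (`|s| + Lx * `|s|) * `|k| by rewrite ler_wpM2r // lerD2l.
  rewrite /B; lra.
have S0 := normr_ge0 s; clearbody B.
clear s1 s2 s3 s4 s5 s6 d10 d20 d30 d40 d50 d60 dh0 h3 h4 X1 Y1 T2.
have F1 : `|Th' (v' - v - s *: k)| <= C * (2 * e1 * `|s|).
  by apply: le_trans TB _; rewrite ler_wpM2l.
have F2 : `|s *: (Th' k - b)| <= `|s| * (e / 4).
  rewrite normrZ ler_wpM2l //; apply: le_trans K1 _; lra.
have F3 : e2 * (`|s| + `|h|) * `|v| <= `|s| * (e / 4).
  have h1 : e2 * (`|s| + `|h|) * `|v| <= e2 * (`|s| + Lx * `|s|) * `|v|.
    by rewrite ler_wpM2r // ler_pM2l // lerD2l.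
  have h2 : e2 * (1 + (1 + Lx) * `|v|) = e / 4 by rewrite divfK // gt_eqF.
  have : `|s| * (e2 * ((1 + Lx) * `|v|)) <= `|s| * (e / 4) by rewrite ler_wpM2l //; lra.
  lra.
have F4 : c * `|h - s *: f t (x t)| * `|v| <= c * (e1 * `|s|) * `|v|.
  by rewrite ler_wpM2r // ler_wpM2l.
have F5 : C * (2 * e1 * `|s|) + c * (e1 * `|s|) * `|v| <= `|s| * (e / 4).
  have h2 : e1 * (1 + 2 * C + c * `|v|) = e / 4 by rewrite divfK // gt_eqF.
  have : `|s| * (e1 * (2 * C + c * `|v|)) <= `|s| * (e / 4) by rewrite ler_wpM2l //; lra.
  lra.
apply: le_trans (ler_normD _ _) _; apply: le_trans (lerD (ler_normD _ _) (lexx _)) _.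
apply: le_trans (lerD (lerD (ler_normD _ _) (lexx _)) (lexx _)) _.
have F0 : 0 <= `|s| * e by rewrite mulr_ge0 // ltW.
lra.
Qed.

End transport.

(** One factor [C] comes from [Th] at time 0 and the other from its inverse at time [t]; in between,
    the norm of the transported difference is followed directly, so no further factor arises. *)
Lemma local_contraction (R : realType) (V W : normedModType R)
    (f ft : R -> V -> V) (fu : R -> V -> V -> V) (Th Tht : R -> V -> V -> W)
    (Thu : R -> V -> V -> V -> W) (T C lambda eps : R) (x : R -> V) :
  0 <= T -> 0 <= C -> 0 < eps ->
  hs_diff f ft fu -> hs_continuous ft (@dist_vec _ V) ->
  hs_continuous fu (@dist_op _ V V) -> hs_diff_op Th Tht Thu ->
  (forall (t : R) (u : V), 0 <= t -> islinear (Th t u)) ->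
  (forall (t : R) (u v : V), 0 <= t -> `|Th t u v| <= C * `|v|) ->
  (forall (t : R) (u v : V), 0 <= t -> `|v| <= C * `|Th t u v|) ->
  (forall (t : R) (u v : V), 0 <= t -> Th t u v != 0 ->
     semi_ip (Th t u v) (Gop f fu Th Tht Thu t u v) / `|Th t u v| ^+ 2 <= lambda) ->
  sol_on f T x ->
  exists2 d : R, 0 < d & forall y, sol_on f T y -> `|y 0 - x 0| < d ->
    forall t : R, 0 <= t <= T ->
      `|y t - x t| <= C ^+ 2 * expR ((lambda + eps) * t) * `|y 0 - x 0|.
Proof.
move=> T0 C0 eps0 fdiff ftc fuc Thdiff Thlin Thle Thge Glog xsol.
have C20 : 0 < 1 + C ^+ 2 by rewrite ltr_pwDl // exprn_ge0.
(* The linearization error is measured against the norm of [v] and then transported, each of which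
   costs a factor [C]; relative to the norm of [w] it is at most [C ^+ 2 * e'], hence at most
   [eps]. *)
have e'0 : 0 < eps / (1 + C ^+ 2) by rewrite divr_gt0.
set e' := eps / (1 + C ^+ 2) in e'0.
have Ce' : C ^+ 2 * e' <= eps.
  rewrite /e' mulrA ler_pdivrMr // mulrC ler_pM2l // lerDr //.
have [r r0 Hr] := tube_differentiable T0 fdiff ftc fuc xsol e'0.
have C1 : 0 < 1 + C by lra.
pose mu := lambda + eps.
set E := expR (`|mu| * T); have E0 : 0 < E by apply: expR_gt0.
(* While the transported difference is at most [rho], the difference itself is at most [C * rho],
   hence at most [r], and the tube estimate applies. *)
pose rho := r / (1 + C).
have rho0 : 0 < rho by rewrite divr_gt0.
exists (rho / (E * (1 + C))); first by rewrite divr_gt0 // mulr_gt0.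
move=> y ysol; rewrite ltr_pdivlMr ?mulr_gt0 // => yx.
pose del t := Th t (x t) (y t - x t).
pose phi t := `|del t|.
have phi_0 : phi 0 <= C * `|y 0 - x 0| by apply: Thle; rewrite lexx.
have Ephi : E * phi 0 < rho.
  apply: le_lt_trans yx; rewrite mulrCA ler_pM2l //.
  apply: le_trans phi_0 _; rewrite [leRHS]mulrC ler_wpM2r //; lra.
suff H t : 0 <= t <= T -> phi t <= expR (mu * t) * phi 0.
  move=> t tT; have t0 : 0 <= t by case/andP: tT.
  apply: le_trans (Thge t (x t) _ t0) _.
  rewrite expr2 -!mulrA ler_wpM2l //.
  apply: le_trans (H t tT) _; rewrite [leRHS]mulrCA.
  by apply: ler_wpM2l phi_0; exact: expR_ge0.
have Tder := transport_derivative Thdiff Thlin Thle C0 xsol ysol.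
move: t; apply: (le_expR_growth (rho := rho)) => //; first by move=> t _; exact: normr_ge0.
- move=> t tT e e0; have tT' : 0 <= t <= T by lra.
  have [d d0 Hd] := Tder t tT' 1 ltr01.
  set D := _ + _ + _ in Hd.
  have D0 : 0 < 1 + `|D| by rewrite ltr_pwDl.
  exists (Num.min d (e / (1 + `|D|))); first by rewrite lt_min d0 divr_gt0.
  move=> s /andP[s0 st]; rewrite lt_min ltr_pdivlMr // => /andP[ts te].
  have sT : 0 <= s <= T by lra.
  have := Hd (s - t); rewrite subrKC (distrC s) gtr0_norm ?subr_gt0 // => /(_ sT ts).
  rewrite -/(del s) -/(del t) => h1.
  have h2 : phi t <= phi s + `|del s - del t|.
    by rewrite -lerBlDl distrC; apply: lerB_dist.
  have h3 : `|del s - del t| <= `|del s - del t - (s - t) *: D| + `|(s - t) *: D|.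
    by rewrite -{1}(subrK ((s - t) *: D) (del s - del t)); apply: ler_normD.
  rewrite normrZ (distrC s) gtr0_norm ?subr_gt0 // in h3.
  lra.
- move=> t /andP[t0 tltT] phirho e e0; have tT' : 0 <= t <= T by rewrite t0 ltW.
  set v := y t - x t; set w := Th t (x t) v.
  have w_phi : `|w| = phi t by [].
  set G := Gop f fu Th Tht Thu t (x t) v.
  have vw : `|v| <= C * `|w| by apply: Thge.
  have e20 : 0 < e / 2 by rewrite divr_gt0.
  have [d1 d10 Hd1] : exists2 d1 : R, 0 < d1 & forall s : R, 0 < s < d1 ->
      `|w + s *: G| <= `|w| + s * (lambda * `|w| + e / 2).
    (* The logarithmic norm only tests nonzero vectors. If [w] vanishes, then so does [v], and [G]
       vanishes by linearity. *)
    have [w0|w0] := eqVneq w 0; last first.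
      exact: (semi_ip_norm_growth w0 (Glog t (x t) v t0 w0)).
    have v0 : v = 0.
      by apply/eqP; rewrite -normr_le0; apply: le_trans vw _; rewrite w0 normr0 mulr0.
    have [[lin1 _] [_ [lin2 _]]] := Thdiff t (x t) t0.
    have [lin2' _] := lin2 (f t (x t)).
    have [[lin3 _] _] := fdiff t (x t) t0.
    have G0 : G = 0.
      rewrite /G /Gop v0 (islinear0 lin1) (islinear0 lin2') (islinear0 lin3).
      by rewrite (islinear0 (Thlin t (x t) t0)) !addr0.
    exists 1 => // s /andP[s0 _]; rewrite G0 w0 scaler0 addr0 normr0 mulr0 !add0r.
    by rewrite mulr_ge0 // ltW.
  have [d2 d20 Hd2] := Tder t tT' _ e20.
  exists (Num.min d1 d2); first by rewrite lt_min d10.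
  move=> s; rewrite lt_min => /andP[s0 /andP[sd1 sd2]] tsT.
  have h1 := Hd1 s (introT andP (conj s0 sd1)).
  have tsT' : 0 <= t + s <= T by rewrite tsT andbT addr_ge0 // ltW.
  have := Hd2 s tsT'; rewrite gtr0_norm // => /(_ sd2).
  rewrite -/v -/w -/(del (t + s)) => h2.
  set k := f t (y t) - f t (x t) in h2.
  have vr : `|v| <= r.
    apply: le_trans vw _; rewrite w_phi.
    apply: (@le_trans _ _ (C * rho)); first by rewrite ler_wpM2l.
    by rewrite /rho mulrA ler_pdivrMr // mulrC ler_pM2l // lerDr.
  have h3 : `|k - fu t (x t) v| <= e' * `|v|.
    by have := Hr t tT' v vr; rewrite /v subrKC.
  have h4 : `|Th t (x t) (k - fu t (x t) v)| <= eps * `|w|.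
    apply: le_trans (Thle t (x t) _ t0) _.
    apply: (@le_trans _ _ (C * (e' * (C * `|w|)))).
      rewrite ler_wpM2l //; apply: le_trans h3 _; rewrite ler_pM2l //.
    rewrite (_ : C * _ = C ^+ 2 * e' * `|w|); last by ring.
    by rewrite ler_wpM2r.
  (* The remainder of the derivative costs [e / 2], the middle term grows by the logarithmic norm at
     rate [lambda] plus [e / 2], and the linearization error contributes the [eps] in the rate. *)
  have -> : phi (t + s) = `|(del (t + s) - w - s *: (G + Th t (x t) (k - fu t (x t) v)))
      + (w + s *: G) + s *: Th t (x t) (k - fu t (x t) v)|.
    rewrite scalerDr -(addrA _ (w + _)) -(addrA w) (addrA w) -/(phi _).
    by rewrite -(addrA w) -(addrA _ (- w)) -opprD subrK.
  have GE : G + Th t (x t) (k - fu t (x t) v) =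
      Tht t (x t) v + Thu t (x t) (f t (x t)) v + Th t (x t) k.
    by rewrite (islinearB _ _ (Thlin t (x t) t0)) /G /Gop -addrA subrKC.
  rewrite GE; apply: le_trans (ler_normD _ _) _.
  apply: le_trans (lerD (ler_normD _ _) (lexx _)) _.
  rewrite normrZ (gtr0_norm s0).
  have h5 : s * `|Th t (x t) (k - fu t (x t) v)| <= s * (eps * `|w|) by rewrite ler_pM2l.
  rewrite -w_phi /mu.
  lra.
Qed.

(** * Continuation along the segment of initial values *)

Section continuation.
Variables (R : realType) (V : completeNormedModType R) (f : R -> V -> V).
Variables (T M : R) (N : R -> R) (u1 u2 : R -> V).
Hypotheses (T0 : 0 <= T) (NM : forall t : R, 0 <= t <= T -> N t <= M).
Hypothesis N0 : forall t : R, 0 <= t <= T -> 0 <= N t.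
Hypothesis fcont : forall (t : R) (u : V), 0 <= t -> forall e : R, 0 < e ->
  exists2 d : R, 0 < d &
    forall (t' : R) (u' : V), 0 <= t' -> `|t' - t| < d -> `|u' - u| < d ->
      `|f t' u' - f t u| <= e.
Hypothesis near_exists : forall x, sol_on f T x -> exists2 d : R, 0 < d &
  forall p : V, `|p - x 0| < d -> exists2 y, sol_on f T y & y 0 = p.
Hypothesis near_close : forall x, sol_on f T x -> exists2 d : R, 0 < d &
  forall y, sol_on f T y -> `|y 0 - x 0| < d ->
    forall t : R, 0 <= t <= T -> `|y t - x t| <= N t * `|y 0 - x 0|.
Hypotheses (u1sol : sol_on f T u1) (u2sol : sol_on f T u2).

Let p (s : R) := u1 0 + s *: (u2 0 - u1 0).

Let pB s s' : p s - p s' = (s - s') *: (u2 0 - u1 0).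
Proof. by rewrite /p opprD addrACA subrr add0r scalerBl. Qed.

Let K0 : 0 < 1 + `|u2 0 - u1 0|.
Proof. by rewrite ltr_pwDl. Qed.

(** [Y] is an arbitrary choice of solutions with no continuity in [s] assumed: [near_close] compares
    [Y s] with every solution that starts nearby, hence with the neighbouring members. Only its
    radius depends on [s], not the constant [N t]. *)
Lemma family_lipschitz (Y : R -> R -> V) (a b : R) : a <= b ->
  (forall s, a <= s <= b -> sol_on f T (Y s) /\ Y s 0 = p s) ->
  forall t : R, 0 <= t <= T ->
    `|Y b t - Y a t| <= N t * `|u2 0 - u1 0| * (b - a).
Proof.
move=> ab HY t tT; apply: (@lipschitz_of_local _ _ a b _ (Y^~ t) ab) => s sab.
have [Ysol Y0] := HY s sab.
have [d d0 Hd] := near_close Ysol.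
exists (d / (1 + `|u2 0 - u1 0|)); first by rewrite divr_gt0.
move=> s' s'ab; rewrite ltr_pdivlMr // => ss'.
have [Y'sol Y'0] := HY s' s'ab.
have := Hd (Y s') Y'sol; rewrite Y'0 Y0 pB normrZ => H.
rewrite -mulrA (mulrC `|u2 0 - u1 0|); apply: H => //.
apply: le_lt_trans ss'; rewrite ler_wpM2l // lerDr //.
Qed.

Lemma segment_solutions (s : R) : 0 <= s <= 1 ->
  exists y, sol_on f T y /\ y 0 = p s.
Proof.
apply: (@real_induction _ 0 1 (fun s => exists y, sol_on f T y /\ y 0 = p s)).
- by exists u1; split=> //; rewrite /p scale0r addr0.
- move=> t tT [y [ysol y0]]; have [d d0 Hd] := near_exists ysol.
  exists (d / (1 + `|u2 0 - u1 0|)); first by rewrite divr_gt0.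
  move=> s' /andP[ts' s't] _.
  have [|z zsol z0] := Hd (p s'); last by exists z.
  rewrite y0 pB normrZ gtr0_norm ?subr_gt0 //.
  apply: (@le_lt_trans _ _ ((s' - t) * (1 + `|u2 0 - u1 0|))).
    by rewrite ler_wpM2l ?subr_ge0 ?(ltW ts') // lerDr.
  by rewrite -ltr_pdivlMr // ltrBlDl.
- move=> b /andP[b0 b1] Hb.
  have /choice[Y HY] : forall s : R, exists y, 0 <= s < b -> sol_on f T y /\ y 0 = p s.
    move=> s'; have [s'b|] := boolP (0 <= s' < b); last by exists u1.
    by have [y Hy] := Hb s' s'b; exists y.
  (* The parameters stay strictly below [b], where solutions are already available, and the
     Lipschitz bound turns their distances into the rate [c / n.+1%:R]. Bounding [N t] by [M] makes
     the rate uniform in time, as the limit of solutions requires. *)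
  pose sn n := b - b / n.+1%:R.
  have snb n : 0 <= sn n < b.
    rewrite /sn subr_ge0 ltrBlDr ltrDl divr_gt0 ?ltr0n // andbT.
    by rewrite ler_pdivrMr ?ltr0n // ler_peMr ?ler1n // ltW.
  have bn0 n : 0 <= b / n.+1%:R by rewrite divr_ge0 // ltW.
  pose c := M * `|u2 0 - u1 0| * b.
  have zc t : 0 <= t <= T -> forall n m, (n <= m)%N ->
      `|Y (sn n) t - Y (sn m) t| <= c / n.+1%:R.
    move=> tT n m nm.
    have snm : sn n <= sn m.
      by rewrite lerD2l lerN2 ler_pM2l // lef_pV2 ?posrE ?ltr0n // ler_nat.
    have HYnm s' : sn n <= s' <= sn m -> sol_on f T (Y s') /\ Y s' 0 = p s'.
      move=> /andP[h1 h2]; apply: HY.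
      have /andP[h3 _] := snb n; have /andP[_ h4] := snb m.
      by rewrite (le_trans h3 h1) (le_lt_trans h2 h4).
    rewrite distrC; apply: le_trans (family_lipschitz snm HYnm tT) _.
    have -> : c / n.+1%:R = M * `|u2 0 - u1 0| * (b / n.+1%:R) by rewrite /c mulrA.
    apply: ler_pM; rewrite ?mulr_ge0 ?N0 ?subr_ge0 //.
      by rewrite ler_wpM2r // NM.
    by rewrite /sn; move: (b / m.+1%:R) (bn0 m) (b / n.+1%:R) => q q0 q'; lra.
  have /choice[x Hx] : forall t, exists l, 0 <= t <= T ->
      forall n, `|Y (sn n) t - l| <= c / n.+1%:R.
    move=> t; have [tT|] := boolP (0 <= t <= T); last by exists 0.
    by have [l Hl] := seq_lim_bound (zc t tT); exists l.
  exists x; split.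
    apply: (@sol_on_lim _ _ f T c (fun n => Y (sn n))) => // [n|n t tT]; last exact: Hx.
    by have [] := HY _ (snb n).
  have T00 : (0 : R) <= 0 <= T by apply/andP; split.
  apply/eqP; rewrite -subr_eq0 -normr_le0.
  apply: (@le_of_inv_nat _ _ _ (c + b * `|u2 0 - u1 0|)) => n.
  have [_ Yn0] := HY _ (snb n); have := Hx 0 T00 n; rewrite Yn0 distrC => h1.
  rewrite -(subrK (p (sn n)) (x 0)) -addrA; apply: le_trans (ler_normD _ _) _.
  rewrite pB normrZ add0r mulrDl lerD //.
  by rewrite /sn addrAC subrr add0r normrN ger0_norm // mulrAC.
Qed.

Lemma sol_on_contraction (t : R) : 0 <= t <= T ->
  `|u1 t - u2 t| <= N t * `|u1 0 - u2 0|.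
Proof.
move=> tT.
have /choice[Y HY] : forall s : R, exists y, 0 <= s <= 1 -> sol_on f T y /\ y 0 = p s.
  move=> s; have [sI|] := boolP (0 <= s <= 1); last by exists u1.
  by have [y Hy] := segment_solutions sI; exists y.
(* Uniqueness is the local estimate at initial distance 0. It identifies the chosen solutions at the
   ends of the segment with [u1] and [u2]. *)
have uniq y z : sol_on f T y -> sol_on f T z -> y 0 = z 0 -> y t = z t.
  move=> ysol zsol yz; have [d d0 Hd] := near_close zsol.
  have := Hd y ysol; rewrite yz subrr normr0 => /(_ d0 t tT); rewrite mulr0.
  by rewrite normr_le0 subr_eq0 => /eqP.
have [Y0sol Y00] := HY 0 (introT andP (conj (lexx 0) ler01)).
have [Y1sol Y10] := HY 1 (introT andP (conj ler01 (lexx 1))).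
have := family_lipschitz ler01 HY tT.
rewrite subr0 mulr1 (uniq _ u1 Y0sol u1sol); last by rewrite Y00 /p scale0r addr0.
rewrite (uniq _ u2 Y1sol u2sol); last by rewrite Y10 /p scale1r subrKC.
by rewrite distrC (distrC (u2 0)).
Qed.

End continuation.

Theorem mainTheorem3 (R : realType) (V W : completeNormedModType R)
  (f : R -> V -> V) (fu : R -> V -> V -> V)
  (Th : R -> V -> V -> W) (Thinv : R -> V -> W -> V)
  (Tht : R -> V -> V -> W) (Thu : R -> V -> V -> V -> W) (C lambda : R) :
  C1_hs_vec f fu ->
  C1_hs_op Th Tht Thu ->
  (forall (t : R) (u : V), 0 <= t ->
     [/\ bounded_lin (Th t u), bounded_lin (Thinv t u),
         cancel (Th t u) (Thinv t u) & cancel (Thinv t u) (Th t u)]) ->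
  ereal_sup [set maxe (opnorm (Th p.1 p.2)) (opnorm (Thinv p.1 p.2))
            | p in [set p : R * V | (0 <= p.1)%R]] = C%:E ->
  (ereal_sup [set logM (fun w : W => Gop f fu Th Tht Thu p.1 p.2 (Thinv p.1 p.2 w))
             | p in [set p : R * V | (0 <= p.1)%R]] <= lambda%:E)%E ->
  forall u1 u2 : R -> V, is_solution f u1 -> is_solution f u2 ->
  forall t : R, 0 <= t ->
    `|u1 t - u2 t| <= C ^+ 2 * expR (lambda * t) * `|u1 0 - u2 0|.
Proof.
move=> [ft [fdiff [ftc fuc]]] [Thdiff _] Thbij supC supG u1 u2 u1sol u2sol T T0.
have Thlin (t : R) u : 0 <= t -> islinear (Th t u) by move=> /(Thbij t u)[[]].
have normsC (t : R) u : 0 <= t ->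
    (maxe (opnorm (Th t u)) (opnorm (Thinv t u)) <= C%:E)%E.
  by move=> t0; rewrite -supC; apply: ereal_sup_ubound; exists (t, u).
have Thle (t : R) u v : 0 <= t -> `|Th t u v| <= C * `|v|.
  move=> t0; apply: opnorm_le; first exact: Thlin.
  by apply: le_trans (normsC t u t0); rewrite le_max lexx.
have Thge (t : R) u v : 0 <= t -> `|v| <= C * `|Th t u v|.
  move=> t0; have [_ [inv_lin _] ThK _] := Thbij t u t0.
  rewrite -{1}(ThK v); apply: opnorm_le => //.
  by apply: le_trans (normsC t u t0); rewrite le_max lexx orbT.
have C0 : 0 <= C.
  rewrite -lee_fin; apply: le_trans (normsC 0 0 (lexx 0)).
  by rewrite le_max (opnorm_ge0 (Thlin 0 0 (lexx 0))).
have Glog (t : R) u v : 0 <= t -> Th t u v != 0 ->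
    semi_ip (Th t u v) (Gop f fu Th Tht Thu t u v) / `|Th t u v| ^+ 2 <= lambda.
  move=> t0 v0; have [_ _ ThK _] := Thbij t u t0.
  rewrite -lee_fin; apply: le_trans supG.
  (* The supremum is tested on the vector [Th t u v], on which [Thinv] cancels. *)
  apply: (@le_trans _ _ (logM (fun w : W => Gop f fu Th Tht Thu t u (Thinv t u w)))).
    by apply: ereal_sup_ubound; exists (Th t u v) => //=; rewrite ThK.
  by apply: ereal_sup_ubound; exists (t, u).
have fcont := hs_diff_continuous fdiff ftc fuc.
have TT : 0 <= T <= T by rewrite T0 lexx.
have bound eps : 0 < eps ->
    `|u1 T - u2 T| <= C ^+ 2 * expR ((lambda + eps) * T) * `|u1 0 - u2 0|.
  move=> eps0; pose mu := lambda + eps.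
  have NM (t : R) : 0 <= t <= T ->
      C ^+ 2 * expR (mu * t) <= C ^+ 2 * expR (`|mu| * T).
    move=> /andP[t0 tT]; rewrite ler_wpM2l ?exprn_ge0 // ler_expR.
    apply: (@le_trans _ _ (`|mu| * t)); first by rewrite ler_wpM2r // ler_norm.
    by rewrite ler_wpM2l.
  apply: (@sol_on_contraction _ V f T _ _ u1 u2 T0 NM) => //.
  - by move=> t _; rewrite mulr_ge0 ?exprn_ge0 // expR_ge0.
  - by move=> x xsol; apply: (sol_on_exists_near T0 fdiff ftc fuc xsol).
  - by move=> x xsol; apply: (local_contraction T0 C0 eps0 fdiff ftc fuc Thdiff Thlin Thle Thge Glog xsol).
  - exact: is_solution_sol_on.
  - exact: is_solution_sol_on.
(* The limit in [eps] is taken quantitatively: moving [expR (eps * T)] to the left and using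
   [1 - eps * T <= expR (- (eps * T))] leaves an excess of at most [eps * a * T], and [eps] is
   chosen to make this at most [eta]. *)
apply/ler_addgt0Pr => eta eta0.
have aT0 : 0 < 1 + `|u1 T - u2 T| * T by rewrite ltr_pwDl // mulr_ge0.
pose eps := eta / (1 + `|u1 T - u2 T| * T).
have eps0 : 0 < eps by rewrite divr_gt0.
have epsE : eps * (1 + `|u1 T - u2 T| * T) = eta by rewrite divfK // gt_eqF.
have := bound eps eps0; rewrite mulrDl expRD mulrA mulrAC.
set X := _ * `|u1 0 - u2 0|; set a := `|u1 T - u2 T| in epsE *.
rewrite -ler_pdivrMr ?expR_gt0 // -expRN => h1.
have h2 : a * (1 - eps * T) <= a * expR (- (eps * T)).
  by apply: ler_wpM2l; [exact: normr_ge0|exact: expR_ge1Dx].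
lra.
Qed.
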